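(* Suppose $0\le 1/n \ll \eta_2\ll\epsilon_2\ll\eta'_2\ll d_2\ll\eta_3\ll\epsilon_3\ll\eta'_3\ll\epsilon', d_3<1$, that $H$ is a tripartite $3$-complex on $X=X_1\cup X_2\cup X_3$ with $H_{\{i\}}=X_i$ and $|X_i|\ge n$ for $1\le i\le 3$, that $H_{12},H_{13},H_{23}$ are $\eta_2$-quasirandom with density at least $d_2$, and that $H_{123}$ is $\eta_3$-quasirandom with relative density at least $d_3$ with respect to $H$. Then in the auxiliary complex $H'$, each $H'_{ij}$ is $\eta'_2$-quasirandom with density $(1\pm\epsilon_2)d_{ij}(H)^4$, and $H'_{123}$ is $\eta'_3$-quasirandom with relative density $(1\pm\epsilon_3)d_{123}(H)^8$ with respect to $H'$. Furthermore, if $G_i$ is a graph on $X_i$ with $|E(G_i)|>\epsilon'|X_i|^2$ for $1\le i\le 3$, and edges $x_ix_i'$ of $G_i$ ($1\le i\le 3$) are selected uniformly and independently at random, then with probability $(1\pm\epsilon')\,d_{12}(H)^4d_{13}(H)^4d_{23}(H)^4d_{123}(H)^8$ all eight triples $\{u_1,u_2,u_3\}$ with $u_i\in\{x_i,x_i'\}$ belong to $H_{123}$.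
   Context: Hierarchy convention: ''$0<\alpha\ll\beta$'' means there is an increasing function $f$ such that the statement holds whenever $0<\alpha<f(\beta)$; chains are read right to left. A tripartite $3$-complex on disjoint sets $X_1,X_2,X_3$ is $H = \bigcup_{I\subseteq\{1,2,3\}} H_I$ with $H_\emptyset=\{\emptyset\}$, $H_{\{i\}}\subseteq X_i$, $H_{ij}$ ($i<j$) a bipartite graph between $H_{\{i\}}$ and $H_{\{j\}}$, and $H_{123}$ a set of triples contained in the set $H_{123}^*$ of triangles spanned by $H_{12}\cup H_{13}\cup H_{23}$. Sets are identified with characteristic functions. $d_{ij}(H)=|H_{ij}|/(|X_i||X_j|)$ and relative density $d_{123}(H)=|H_{123}|/|H^*_{123}|$. A graph $H_{ij}$ is $\eta$-quasirandom if $\mathbb{E}_{x,x'\in X_i,y,y'\in X_j} f(x,y)f(x,y')f(x',y)f(x',y')<\eta$ for $f=H_{ij}-d_{ij}$. For $f:X_1\times X_2\times X_3\to[-1,1]$, $O_3(f)=\mathbb{E}\prod_{(e_1,e_2,e_3)\in\{0,1\}^3} f(x_1^{e_1},x_2^{e_2},x_3^{e_3})$ over independent uniform $x_i^0,x_i^1\in X_i$; $H_{123}$ is $\eta$-quasirandom with respect to $H$ if $O_3(H_{123}-d_{123}H^*_{123})<\eta(d_{12}d_{13}d_{23})^4$. The auxiliary complex $H'$ is the tripartite $3$-complex on $X'=X'_1\cup X'_2\cup X'_3$ where $X'_i$ is the set of all ordered pairs $(x_i^0,x_i^1)\in X_i^2$ (equivalently maps $\{a_i^0,a_i^1\}\to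 X_i$), $H'_{\{i\}}=X'_i$; $H'_{ij}$ consists of those pairs of elements $(x_i^0,x_i^1)\in X'_i$, $(x_j^0,x_j^1)\in X'_j$ with $x_i^sx_j^t\in H_{ij}$ for all $s,t\in\{0,1\}$; and $H'_{123}$ consists of those triples with $x_i^sx_j^t\in H_{ij}$ for all $i<j$, $s,t$, and $x_1^{e_1}x_2^{e_2}x_3^{e_3}\in H_{123}$ for all $(e_1,e_2,e_3)\in\{0,1\}^3$. Densities and quasirandomness for $H'$ are defined in the same way with $X'_i$ in place of $X_i$. $a\pm b$ denotes a number in $[a-b,a+b]$. *)

(* Defs.v *)
From HB Require Import structures.
From mathcomp Require Import all_boot all_order all_algebra.
Set Implicit Arguments. Unset Strict Implicit. Unset Printing Implicit Defensive.
Import Order.TTheory GRing.Theory Num.Theory.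
Local Open Scope ring_scope.

(* A tripartite 3-complex with H_{i} = X_i (the vertex classes are the
   finite types X1, X2, X3, automatically disjoint).  Edge sets and the
   triple set are given by their characteristic functions. *)
Record cplx (X1 X2 X3 : finType) := Cplx {
  c12 : X1 -> X2 -> bool;
  c13 : X1 -> X3 -> bool;
  c23 : X2 -> X3 -> bool;
  c123 : X1 -> X2 -> X3 -> bool }.

Definition star (X1 X2 X3 : finType) (H : cplx X1 X2 X3) x y z :=
  [&& c12 H x y, c13 H x z & c23 H y z].

Definition is_complex (X1 X2 X3 : finType) (H : cplx X1 X2 X3) :=
  forall x y z, c123 H x y z -> star H x y z.

Definition avg (R : realFieldType) (T : finType) (F : T -> R) : R :=
  (\sum_(x : T) F x) / #|T|%:R.

Definition dens (R : realFieldType) (A B : finType) (g : A -> B -> bool) : R :=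
  (\sum_(x : A) \sum_(y : B) (g x y : nat)%:R) / (#|A| * #|B|)%:R.

Definition graph_qr (R : realFieldType) (A B : finType) (eta : R)
    (g : A -> B -> bool) : Prop :=
  let f := fun x y => (g x y : nat)%:R - dens R g in
  avg (fun x : A => avg (fun x' : A => avg (fun y : B => avg (fun y' : B =>
     f x y * f x y' * f x' y * f x' y')))) < eta.

Definition d12 (R : realFieldType) X1 X2 X3 (H : @cplx X1 X2 X3) : R := dens R (c12 H).
Definition d13 (R : realFieldType) X1 X2 X3 (H : @cplx X1 X2 X3) : R := dens R (c13 H).
Definition d23 (R : realFieldType) X1 X2 X3 (H : @cplx X1 X2 X3) : R := dens R (c23 H).

Definition d123 (R : realFieldType) X1 X2 X3 (H : @cplx X1 X2 X3) : R :=
  (\sum_(x : X1) \sum_(y : X2) \sum_(z : X3) (c123 H x y z : nat)%:R) /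
  (\sum_(x : X1) \sum_(y : X2) \sum_(z : X3) (star H x y z : nat)%:R).

Definition sel (T : Type) (b : bool) (a0 a1 : T) := if b then a1 else a0.

Definition O3 (R : realFieldType) (X1 X2 X3 : finType) (f : X1 -> X2 -> X3 -> R) : R :=
  avg (fun x0 : X1 => avg (fun x1 : X1 =>
  avg (fun y0 : X2 => avg (fun y1 : X2 =>
  avg (fun z0 : X3 => avg (fun z1 : X3 =>
    \prod_(e1 : bool) \prod_(e2 : bool) \prod_(e3 : bool)
       f (sel e1 x0 x1) (sel e2 y0 y1) (sel e3 z0 z1))))))).

Definition tri_qr (R : realFieldType) X1 X2 X3 (eta : R) (H : @cplx X1 X2 X3) : Prop :=
  O3 (fun x y z => (c123 H x y z : nat)%:R - d123 R H * (star H x y z : nat)%:R)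
    < eta * (d12 R H * d13 R H * d23 R H) ^+ 4.

Definition aux12 X1 X2 X3 (H : @cplx X1 X2 X3) (p : X1 * X1) (q : X2 * X2) :=
  [forall s : bool, forall t : bool, c12 H (sel s p.1 p.2) (sel t q.1 q.2)].
Definition aux13 X1 X2 X3 (H : @cplx X1 X2 X3) (p : X1 * X1) (q : X3 * X3) :=
  [forall s : bool, forall t : bool, c13 H (sel s p.1 p.2) (sel t q.1 q.2)].
Definition aux23 X1 X2 X3 (H : @cplx X1 X2 X3) (p : X2 * X2) (q : X3 * X3) :=
  [forall s : bool, forall t : bool, c23 H (sel s p.1 p.2) (sel t q.1 q.2)].
Definition aux123 X1 X2 X3 (H : @cplx X1 X2 X3) (p : X1 * X1) (q : X2 * X2) (r : X3 * X3) :=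
  [&& aux12 H p q, aux13 H p r, aux23 H q r &
      [forall e1 : bool, forall e2 : bool, forall e3 : bool,
         c123 H (sel e1 p.1 p.2) (sel e2 q.1 q.2) (sel e3 r.1 r.2)]].

Definition aux X1 X2 X3 (H : @cplx X1 X2 X3) :
    @cplx (X1 * X1)%type (X2 * X2)%type (X3 * X3)%type :=
  Cplx (aux12 H) (aux13 H) (aux23 H) (aux123 H).

Definition is_graph (X : finType) (G : {set {set X}}) :=
  forall e, e \in G -> #|e| = 2%N.

Definition prob_all8 (R : realFieldType) X1 X2 X3 (H : @cplx X1 X2 X3)
    (G1 : {set {set X1}}) (G2 : {set {set X2}}) (G3 : {set {set X3}}) : R :=
  #|[set t : ({set X1} * {set X2}) * {set X3} |
       [&& t.1.1 \in G1, t.1.2 \in G2, t.2 \in G3 &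
        [forall u1 in t.1.1, forall u2 in t.1.2, forall u3 in t.2,
           c123 H u1 u2 u3]]]|%:R
  / (#|G1| * #|G2| * #|G3|)%:R.

(* Main.v *)
(* Quasirandomness enters only through two inequalities. A graph g of density d
   is close to d in cut norm, so in any average each edge factor g(x, y) that is
   the only factor depending on both x and y may be replaced by d; as the graphs
   are far more regular than they are sparse, this counts all graph patterns.
   For triples put F = H_123 - d_123 H*_123. Three applications of
   Cauchy-Schwarz, with the graphs kept as weights, bound an average of F(x, y, z)
   times functions of pairs, inside a complete tripartite configuration with k
   further vertices in each class, by a product of graph counts and the
   octahedral average of F. Edges outside the octahedron can be replaced by their
   densities, and the exponents balance: the bound is a small multiple of
   (d_12 d_13 d_23)^((k+1)^2), however small the graph densities are.

   Writing the eight factors H_123 of H'_123 as d_123 H*_123 + F and telescoping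
   gives the density of H' and the edge statement with k = 1, the indicator
   functions of the G_i being absorbed into the functions of pairs. The
   octahedral average for H' is treated in the same way with k = 3. *)
Require Import Defs.
From HB Require Import structures.
From mathcomp Require Import all_boot all_order all_algebra.
From mathcomp Require Import zify ring lra.
Import Order.TTheory GRing.Theory Num.Theory.
Set Implicit Arguments. Unset Strict Implicit. Unset Printing Implicit Defensive.
Local Open Scope ring_scope.

(** * Averages *)

Section Averages.
Variable R : realFieldType.
Implicit Types S T X Y Z : finType.

(** The obstacle is the order of the constants: [d2] is chosen after [eta3], so a bound on the
    triples that is small only in absolute terms says nothing, and no power of the graph densities
    may be lost in Cauchy-Schwarz. Graph errors, by contrast, can stay absolute throughout, because
    [eta2] is chosen last.

    The field [R] need not contain roots. The errors [delta] and [e] are therefore fixed before the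
    quasirandomness constants and compared with them by [eta3 *+ 256 <= delta ^+ 8] and
    [eta2 <= e ^+ 4].

    In the octahedral average for [H'] only one of the eight doubled triples is expanded; each of
    the other seven misses a vertex of it and so is already a function of two of its doubled
    vertices. Such an octahedron has four vertices of [H] in each class, one selected and three
    others. This is the origin of k = 3 and of an error of order [q ^+ 16], the same order as the
    fourth power of the product of the graph densities of [H']. The balanced function of [H'] is
    centred at its own density but the telescoping at [d123 R H ^+ 8]; the density estimate pays for
    the difference. *)

Lemma eq_avg T (F G : T -> R) : F =1 G -> avg F = avg G.
Proof. by move=> e; rewrite /avg (eq_bigr G). Qed.

Lemma avgD T (F G : T -> R) : avg (fun x => F x + G x) = avg F + avg G.
Proof. by rewrite /avg big_split mulrDl. Qed.

Lemma avgZ T (c : R) (F : T -> R) : avg (fun x => c * F x) = c * avg F.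
Proof. by rewrite /avg -mulr_sumr mulrA. Qed.

Lemma avgN T (F : T -> R) : avg (fun x => - F x) = - avg F.
Proof. by rewrite -mulN1r -avgZ; apply: eq_avg => x; rewrite mulN1r. Qed.

Lemma avgB T (F G : T -> R) : avg (fun x => F x - G x) = avg F - avg G.
Proof. by rewrite avgD avgN. Qed.

Lemma avgZr T (c : R) (F : T -> R) : avg (fun x => F x * c) = avg F * c.
Proof. by rewrite mulrC -avgZ; apply: eq_avg => x; rewrite mulrC. Qed.

Lemma avg_const T (c : R) : (0 < #|T|)%N -> avg (fun _ : T => c) = c.
Proof.
move=> T0; rewrite /avg sumr_const -(mulr_natr c) mulfK //.
by rewrite pnatr_eq0 -lt0n.
Qed.

Lemma le_avg T (F G : T -> R) : (forall x, F x <= G x) -> avg F <= avg G.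
Proof. by move=> h; rewrite ler_wpM2r ?invr_ge0 ?ler0n ?ler_sum. Qed.

Lemma avg_ge0 T (F : T -> R) : (forall x, 0 <= F x) -> 0 <= avg F.
Proof. by move=> h; rewrite divr_ge0 ?ler0n ?sumr_ge0. Qed.

Lemma avg_le_const T (c : R) (F : T -> R) :
  0 <= c -> (forall x, F x <= c) -> avg F <= c.
Proof.
move=> c0 h; have [T0|T0] := posnP #|T|; first by rewrite /avg T0 invr0 mulr0.
by rewrite -[leRHS](avg_const c T0) le_avg.
Qed.

Lemma norm_avg T (F : T -> R) : `|avg F| <= avg (fun x => `|F x|).
Proof.
rewrite normrM [X in _ * X]ger0_norm ?invr_ge0 ?ler0n //.
by rewrite ler_wpM2r ?invr_ge0 ?ler0n ?ler_norm_sum.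
Qed.

Lemma norm_avg_le T (c : R) (F : T -> R) :
  0 <= c -> (forall x, `|F x| <= c) -> `|avg F| <= c.
Proof. by move=> c0 h; apply: le_trans (norm_avg F) _; apply: avg_le_const. Qed.

Lemma exchange_avg S T (F : S -> T -> R) :
  avg (fun x => avg (F x)) = avg (fun y => avg (fun x => F x y)).
Proof.
rewrite /avg -!mulr_suml exchange_big /= -!mulrA; congr (_ * _).
by rewrite mulrC.
Qed.

Lemma avg_pair S T (F : S * T -> R) :
  avg F = avg (fun x => avg (fun y => F (x, y))).
Proof.
rewrite /avg -mulr_suml pair_big /= card_prod natrM invfM -mulrA.
by rewrite [_^-1 * _]mulrC; congr (_ * _); apply: eq_bigr => -[].
Qed.

Lemma avg_unit (F : unit -> R) : avg F = F tt.
Proof.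
rewrite -[RHS](avg_const (T := unit)) ?card_unit //.
by apply: eq_avg; case.
Qed.

Lemma avg_mul S T (F : S -> R) (G : T -> R) :
  avg F * avg G = avg (fun x => avg (fun y => F x * G y)).
Proof. by rewrite -avgZr; apply: eq_avg => x; rewrite avgZ. Qed.

Lemma expr2_avg T (F : T -> R) :
  avg F ^+ 2 = avg (fun x => avg (fun y => F x * F y)).
Proof. by rewrite expr2 avg_mul. Qed.

(** The difference of the two sides is the average over pairs of
    [m x * m y * (G x - G y) ^+ 2 / 2]. *)
Lemma weighted_CS T (m G : T -> R) : (forall t, 0 <= m t) ->
  avg (fun t => m t * G t) ^+ 2 <= avg m * avg (fun t => m t * G t ^+ 2).
Proof.
move=> m0; rewrite expr2 !avg_mul.
rewrite -subr_ge0.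
have -> : avg (fun x => avg (fun y => m x * (m y * G y ^+ 2))) =
  avg (fun x => avg (fun y => m x * m y * (G x ^+ 2 + G y ^+ 2) / 2)).
  have h : avg (fun x => avg (fun y => m x * (m y * G y ^+ 2))) =
    avg (fun x => avg (fun y => m x * (m y * G x ^+ 2))).
    rewrite exchange_avg; apply: eq_avg => x; apply: eq_avg => y; ring.
  apply: (@mulIf _ 2); first by rewrite pnatr_eq0.
  rewrite mulr_natr mulr2n {2}h -avgD -avgZr; apply: eq_avg => x.
  by rewrite -avgD -avgZr; apply: eq_avg => y; field.
rewrite -avgB; apply: avg_ge0 => x; rewrite -avgB; apply: avg_ge0 => y.
have -> : m x * m y * (G x ^+ 2 + G y ^+ 2) / 2 - m x * G x * (m y * G y) =
  m x * m y * ((G x - G y) ^+ 2 / 2) by field.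
by apply: mulr_ge0; [exact: mulr_ge0 | rewrite divr_ge0 ?sqr_ge0].
Qed.

(* The form of Cauchy-Schwarz in which a factor [a] that does not depend on
   the inner variable is discarded and the inner variable is duplicated. *)
Lemma weighted_CS_dup T Z (m a : T -> R) (G : T -> Z -> R) :
  (forall t, 0 <= m t) -> (forall t, `|a t| <= 1) ->
  avg (fun t => avg (fun z => m t * a t * G t z)) ^+ 2 <=
  avg m * avg (fun t => avg (fun z0 => avg (fun z1 => m t * (G t z0 * G t z1)))).
Proof.
move=> m0 a1.
have -> : avg (fun t => avg (fun z => m t * a t * G t z)) =
  avg (fun t => m t * (a t * avg (G t))).
  by apply: eq_avg => t; rewrite avgZ mulrA.
apply: le_trans (weighted_CS _ m0) _.
apply: ler_wpM2l; first exact: avg_ge0.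
apply: le_avg => t.
have -> : avg (fun z0 => avg (fun z1 => m t * (G t z0 * G t z1))) =
  m t * avg (G t) ^+ 2.
  by rewrite expr2_avg -avgZ; apply: eq_avg => z; rewrite avgZ.
apply: ler_wpM2l => //; rewrite exprMn.
rewrite -[leRHS]mul1r ler_wpM2r ?sqr_ge0 // -real_normK ?num_real //.
by rewrite expr_le1.
Qed.

(** The outer variables are packed into one product type. The versions with three, four and five of
    them serve the three steps of [weighted_GCS]. *)
Lemma weighted_CS_dup3 (A B C Z : finType) (m a : A -> B -> C -> R)
    (G : A -> B -> C -> Z -> R) :
  (forall x y z, 0 <= m x y z) -> (forall x y z, `|a x y z| <= 1) ->
  avg (fun x : A => avg (fun y : B => avg (fun z : C =>
    avg (fun w : Z => m x y z * a x y z * G x y z w)))) ^+ 2 <=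
  avg (fun x : A => avg (fun y : B => avg (fun z : C => m x y z))) *
  avg (fun x : A => avg (fun y : B => avg (fun z : C =>
    avg (fun w0 : Z => avg (fun w1 : Z =>
      m x y z * (G x y z w0 * G x y z w1)))))).
Proof.
move=> m0 a1.
have := weighted_CS_dup (T := (A * B * C)%type) (m := fun t => m t.1.1 t.1.2 t.2)
  (a := fun t => a t.1.1 t.1.2 t.2) (fun t => G t.1.1 t.1.2 t.2).
by rewrite !avg_pair /=; apply.
Qed.

Lemma weighted_CS_dup4 (A B C D Z : finType) (m a : A -> B -> C -> D -> R)
    (G : A -> B -> C -> D -> Z -> R) :
  (forall x y z t, 0 <= m x y z t) -> (forall x y z t, `|a x y z t| <= 1) ->
  avg (fun x : A => avg (fun y : B => avg (fun z : C => avg (fun t : D =>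
    avg (fun w : Z => m x y z t * a x y z t * G x y z t w))))) ^+ 2 <=
  avg (fun x : A => avg (fun y : B => avg (fun z : C => avg (fun t : D =>
    m x y z t)))) *
  avg (fun x : A => avg (fun y : B => avg (fun z : C => avg (fun t : D =>
    avg (fun w0 : Z => avg (fun w1 : Z =>
      m x y z t * (G x y z t w0 * G x y z t w1))))))).
Proof.
move=> m0 a1.
have := weighted_CS_dup3 (A := (A * B)%type) (m := fun t => m t.1 t.2)
  (a := fun t => a t.1 t.2) (fun t => G t.1 t.2).
by rewrite !avg_pair /=; apply.
Qed.

Lemma weighted_CS_dup5 (A B C D E Z : finType) (m a : A -> B -> C -> D -> E -> R)
    (G : A -> B -> C -> D -> E -> Z -> R) :
  (forall x y z t u, 0 <= m x y z t u) -> (forall x y z t u, `|a x y z t u| <= 1) ->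
  avg (fun x : A => avg (fun y : B => avg (fun z : C => avg (fun t : D =>
    avg (fun u : E => avg (fun w : Z => m x y z t u * a x y z t u * G x y z t u w)))))) ^+ 2 <=
  avg (fun x : A => avg (fun y : B => avg (fun z : C => avg (fun t : D =>
    avg (fun u : E => m x y z t u))))) *
  avg (fun x : A => avg (fun y : B => avg (fun z : C => avg (fun t : D =>
    avg (fun u : E => avg (fun w0 : Z => avg (fun w1 : Z =>
      m x y z t u * (G x y z t u w0 * G x y z t u w1)))))))).
Proof.
move=> m0 a1.
have := weighted_CS_dup4 (A := (A * B)%type) (m := fun t => m t.1 t.2)
  (a := fun t => a t.1 t.2) (fun t => G t.1 t.2).
by rewrite !avg_pair /=; apply.
Qed.

End Averages.

(** * Graphs close to a constant in cut norm *)

Section Cut.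
Variable R : realFieldType.
Implicit Types X Y Z : finType.

Definition bounded1 (T : Type) (f : T -> R) := forall x, `|f x| <= 1.
Definition bounded2 (S T : Type) (f : S -> T -> R) := forall x y, `|f x y| <= 1.
Definition bounded3 (S T U : Type) (f : S -> T -> U -> R) :=
  forall x y z, `|f x y z| <= 1.

Lemma norm_mul_le1 (a b : R) : `|a| <= 1 -> `|b| <= 1 -> `|a * b| <= 1.
Proof. by move=> ha hb; rewrite normrM mulr_ile1. Qed.

Lemma norm_prod_le1 (I : Type) (r : seq I) (F : I -> R) :
  (forall i, `|F i| <= 1) -> `|\prod_(i <- r) F i| <= 1.
Proof.
move=> h; elim/big_ind: _ => //; first by rewrite normr1.
exact: norm_mul_le1.
Qed.

Lemma norm_exp_le1 (a : R) n : `|a| <= 1 -> `|a ^+ n| <= 1.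
Proof. by move=> h; rewrite normrX exprn_ile1. Qed.

Lemma norm_avg_le1 (T : finType) (F : T -> R) : bounded1 F -> `|avg F| <= 1.
Proof. by move=> h; apply: norm_avg_le. Qed.

(* Closeness of [g] to the constant [d] in cut norm. Unlike [graph_qr] it
   scales linearly in the error, so no roots are needed in the field [R]. *)
Definition cut X Y (g : X -> Y -> R) (d eps : R) :=
  forall u v, bounded1 u -> bounded1 v ->
  `|avg (fun x => avg (fun y => (g x y - d) * u x * v y))| <= eps.

Lemma cut_ge0 X Y (g : X -> Y -> R) d eps : cut g d eps -> 0 <= eps.
Proof.
move=> /(_ (fun=> 0) (fun=> 0)) h; apply: le_trans (normr_ge0 _) (h _ _) => x;
by rewrite normr0.
Qed.

Lemma cut_sym X Y (g : X -> Y -> R) d eps :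
  cut g d eps -> cut (fun y x => g x y) d eps.
Proof.
move=> h u v hu hv; rewrite exchange_avg.
have := h v u hv hu; congr (_ <= _); congr `|_|.
by apply: eq_avg => x; apply: eq_avg => y; ring.
Qed.

Lemma cut_dens X Y (g : X -> Y -> R) d eps :
  (0 < #|X|)%N -> (0 < #|Y|)%N -> cut g d eps ->
  `|avg (fun x => avg (g x)) - d| <= eps.
Proof.
move=> X0 Y0 h.
have := h (fun=> 1) (fun=> 1); rewrite /bounded1 normr1.
move=> /(_ (fun=> lexx _) (fun=> lexx _)); congr (`|_| <= _).
under eq_avg => x do under eq_avg do rewrite !mulr1.
by under eq_avg do rewrite avgB avg_const //; rewrite avgB avg_const.
Qed.

(** Cut-norm estimates for a doubled graph come out centred at [d ^+ 4], whereas quasirandomness is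
    centred at the actual density. *)
Lemma cut_recenter X Y (g : X -> Y -> R) d d' e e' :
  0 <= e' -> `|d - d'| <= e' -> cut g d e -> cut g d' (e + e').
Proof.
move=> e0 hd h u v hu hv.
have -> : avg (fun x => avg (fun y => (g x y - d') * u x * v y)) =
  avg (fun x => avg (fun y => (g x y - d) * u x * v y)) +
  avg (fun x => avg (fun y => (d - d') * (u x * v y))).
  by rewrite -avgD; apply: eq_avg => x; rewrite -avgD; apply: eq_avg => y; ring.
apply: le_trans (ler_normD _ _) _; apply: lerD; first exact: h.
apply: norm_avg_le => // x; apply: norm_avg_le => // y; rewrite normrM.
rewrite -[leRHS]mulr1; apply: ler_pM => //; exact: norm_mul_le1.
Qed.

Lemma CS_dup (T Z : finType) (a : T -> R) (G : T -> Z -> R) : bounded1 a ->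
  avg (fun t => avg (fun z => a t * G t z)) ^+ 2 <=
  avg (fun t => avg (fun z0 => avg (fun z1 => G t z0 * G t z1))).
Proof.
move=> a1; set D := (X in _ <= X).
have D0 : 0 <= D.
  by apply: avg_ge0 => t; rewrite -expr2_avg sqr_ge0.
have := weighted_CS_dup (m := fun=> 1) G (fun=> ler01) a1.
under eq_avg do under eq_avg do rewrite mul1r.
under [X in _ <= _ * X]eq_avg do under eq_avg do under eq_avg do rewrite mul1r.
move=> h; apply: le_trans h _.
by rewrite -[leRHS]mul1r ler_wpM2r // avg_le_const.
Qed.

(** Cauchy-Schwarz removes first [u] and then [v] and leaves the four-cycle average of [g - d];
    squaring twice is the source of [eps ^+ 4]. *)
Lemma cut_of_graph_qr X Y (g : X -> Y -> bool) eta eps :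
  0 <= eps -> eta <= eps ^+ 4 -> graph_qr eta g ->
  cut (fun x y => (g x y)%:R) (dens R g) eps.
Proof.
move=> e0 le qr u v hu hv.
set f := fun x y => (g x y : nat)%:R - dens R g.
set E := avg _.
have h1 : E ^+ 2 <= avg (fun p : Y * Y => avg (fun x =>
    v p.1 * v p.2 * (f x p.1 * f x p.2))).
  have -> : E = avg (fun x => avg (fun y => u x * (f x y * v y))).
    by apply: eq_avg => x; apply: eq_avg => y; rewrite /f; ring.
  apply: le_trans (CS_dup _ hu) _.
  rewrite le_eqVlt; apply/orP; left; apply/eqP.
  rewrite avg_pair /=; under [RHS]eq_avg do rewrite exchange_avg.
  rewrite [RHS]exchange_avg; apply: eq_avg => x; do 2!apply: eq_avg => ?; ring.
have h2 : avg (fun p : Y * Y => avg (fun x =>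
    v p.1 * v p.2 * (f x p.1 * f x p.2))) ^+ 2 <= eta.
  apply: le_trans (CS_dup (fun p x => f x p.1 * f x p.2) _) _.
    by move=> p; apply: norm_mul_le1.
  apply: ltW; move: qr; congr (_ < _).
  rewrite [RHS]exchange_avg; apply: eq_avg => x.
  rewrite [RHS]exchange_avg; apply: eq_avg => x'.
  by rewrite avg_pair; do 2!apply: eq_avg => ? /=; rewrite /f; ring.
rewrite -(@ler_pXn2r _ 4) ?nnegrE //.
rewrite -normrX ger0_norm; last by rewrite exprn_even_ge0.
rewrite (exprM _ 2 2); apply: le_trans le; apply: le_trans h2.
by rewrite ler_pXn2r ?nnegrE ?sqr_ge0 // (le_trans (sqr_ge0 _) h1).
Qed.

(** With [x'] and [y'] fixed, the three other factors of the four-cycle split into a function of [x]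
    and a function of [y], so [cut] applies. *)
Lemma graph_qr_of_cut X Y (g : X -> Y -> bool) eta eps :
  eps < eta -> 0 <= dens R g <= 1 ->
  cut (fun x y => (g x y)%:R) (dens R g) eps -> graph_qr eta g.
Proof.
move=> lt /andP[d0 d1] h; rewrite /graph_qr.
set f := fun x y => (g x y : nat)%:R - dens R g; have e0 := cut_ge0 h.
have f1 x y : `|f x y| <= 1.
  by rewrite /f ler_norml; case: (g x y); rewrite ?mulr1n ?mulr0n; lra.
apply: le_lt_trans lt; apply: le_trans (ler_norm _) _.
rewrite exchange_avg; apply: norm_avg_le => // x'.
under eq_avg do rewrite exchange_avg.
rewrite exchange_avg; apply: norm_avg_le => // y'.
have -> : avg (fun x => avg (fun y => f x y * f x y' * f x' y * f x' y')) =
  avg (fun x => avg (fun y => ((g x y)%:R - dens R g) * f x y' * (f x' y * f x' y'))).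
  by do 2!apply: eq_avg => ?; rewrite /f; ring.
by apply: h => // y; apply: norm_mul_le1.
Qed.

Definition dbl X Y (g : X -> Y -> R) (p : X * X) (q : Y * Y) : R :=
  g p.1 q.1 * g p.1 q.2 * g p.2 q.1 * g p.2 q.2.

(** With one vertex of the pair fixed, [u] depends on the other alone, so the two edges at [y] can
    be replaced in turn. *)
Lemma cut_dbl_left X Y (g : X -> Y -> R) d eps :
  bounded2 g -> `|d| <= 1 -> cut g d eps ->
  cut (fun (p : X * X) y => g p.1 y * g p.2 y) (d ^+ 2) (eps *+ 2).
Proof.
move=> g1 d1 h u v hu hv; have e0 := cut_ge0 h.
have -> : avg (fun p => avg (fun y => (g p.1 y * g p.2 y - d ^+ 2) * u p * v y)) =
  avg (fun x' => avg (fun x => avg (fun y =>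
     (g x y - d) * u (x, x') * (g x' y * v y)))) +
  avg (fun x' => avg (fun x => avg (fun y =>
     (g x y - d) * (d * u (x', x)) * v y))).
  rewrite [X in _ = X + _]exchange_avg -avgD avg_pair; apply: eq_avg => x.
  rewrite -avgD; apply: eq_avg => x'; rewrite /= -avgD.
  by apply: eq_avg => y; ring.
rewrite mulr2n; apply: le_trans (ler_normD _ _) _.
by apply: lerD; apply: norm_avg_le => // x'; apply: h => // t; apply: norm_mul_le1.
Qed.

(** One side is doubled and then, after exchanging the sides, the other; each doubling squares the
    constant and doubles the error. *)
Lemma cut_dbl X Y (g : X -> Y -> R) d eps :
  bounded2 g -> `|d| <= 1 -> cut g d eps -> cut (dbl g) (d ^+ 4) (eps *+ 4).
Proof.
move=> g1 d1 h.
have b2 : bounded2 (fun y (p : X * X) => g p.1 y * g p.2 y).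
  by move=> y p; apply: norm_mul_le1.
have := cut_sym (cut_dbl_left b2 (norm_exp_le1 2 d1) (cut_sym (cut_dbl_left g1 d1 h))).
rewrite -mulrnA -exprM => h2 u v hu hv.
have := h2 u v hu hv; congr (`|_| <= _).
by do 2!apply: eq_avg => ?; rewrite /dbl; ring.
Qed.

(** The edges are replaced in the order 12, 13, 23. Once the vertex outside the current edge is
    fixed, every other factor depends on at most one endpoint of it. *)
Lemma triangle_count X Y Z (g12 : X -> Y -> R) (g13 : X -> Z -> R)
    (g23 : Y -> Z -> R) d12 d13 d23 eps u v w :
  bounded2 g12 -> bounded2 g13 -> bounded2 g23 ->
  `|d12| <= 1 -> `|d13| <= 1 -> `|d23| <= 1 ->
  cut g12 d12 eps -> cut g13 d13 eps -> cut g23 d23 eps ->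
  bounded1 u -> bounded1 v -> bounded1 w ->
  `|avg (fun x => avg (fun y => avg (fun z =>
      g12 x y * g13 x z * g23 y z * (u x * v y * w z)))) -
    d12 * d13 * d23 * (avg u * avg v * avg w)| <= eps *+ 3.
Proof.
move=> b12 b13 b23 e12 e13 e23 h12 h13 h23 hu hv hw; have e0 := cut_ge0 h12.
set E := avg _.
have -> : E - d12 * d13 * d23 * (avg u * avg v * avg w) =
  avg (fun z => avg (fun x => avg (fun y =>
    (g12 x y - d12) * (u x * g13 x z) * (v y * g23 y z * w z)))) +
  (avg (fun y => avg (fun x => avg (fun z =>
    (g13 x z - d13) * (d12 * u x) * (g23 y z * v y * w z)))) +
   avg (fun x => avg (fun y => avg (fun z =>
    (g23 y z - d23) * (d12 * d13 * u x * v y) * w z)))).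
  rewrite [X in _ = X + _]exchange_avg; under [X in _ = X + _]eq_avg do rewrite exchange_avg.
  rewrite [X in _ = _ + (X + _)]exchange_avg.
  have -> : avg u * avg v * avg w =
    avg (fun x => avg (fun y => avg (fun z => u x * v y * w z))).
    rewrite -mulrA (avg_mul v) avg_mul; apply: eq_avg => x.
    rewrite avgZ -avgZ; apply: eq_avg => y; rewrite -avgZ.
    by apply: eq_avg => z; rewrite mulrA.
  rewrite -avgZ -!avgD /E -avgB; apply: eq_avg => x.
  rewrite -avgZ -!avgD -avgB; apply: eq_avg => y.
  rewrite -avgZ -!avgD -avgB; apply: eq_avg => z.
  by ring.
apply: le_trans (ler_normD _ _) _; rewrite mulrS; apply: lerD.
  by apply: norm_avg_le => // z; apply: h12 => t; rewrite ?norm_mul_le1.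
apply: le_trans (ler_normD _ _) _; rewrite mulr2n; apply: lerD.
  by apply: norm_avg_le => // z; apply: h13 => t; rewrite ?norm_mul_le1.
by apply: norm_avg_le => // z; apply: h23 => t; rewrite ?norm_mul_le1.
Qed.

Lemma avg_bij (S T : finType) (h : S -> T) (F : T -> R) :
  bijective h -> avg (fun x => F (h x)) = avg F.
Proof.
move=> bh; rewrite /avg (bij_eq_card bh); congr (_ / _).
by rewrite [RHS](reindex h) //; apply: onW_bij.
Qed.

Lemma avg_tuple0 (T : finType) (F : seq T -> R) :
  avg (fun s : 0.-tuple T => F s) = F [::].
Proof.
rewrite -[RHS](avg_const (T := 0.-tuple T)) ?card_tuple //.
by apply: eq_avg => s; rewrite (tuple0 s).
Qed.

Lemma avg_tupleS (T : finType) n (F : seq T -> R) :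
  avg (fun s : n.+1.-tuple T => F s) =
  avg (fun x => avg (fun s : n.-tuple T => F (x :: s))).
Proof.
pose h (p : T * n.-tuple T) := [tuple of p.1 :: p.2].
have bh : bijective h.
  exists (fun s => (thead s, [tuple of behead s])) => [[x s]|s].
    by congr (_, _); apply: val_inj.
  by rewrite [RHS]tuple_eta.
by rewrite -(avg_bij _ bh) avg_pair.
Qed.

Lemma avg_tuple1 (T : finType) (H : seq T -> R) :
  avg (fun t : 1.-tuple T => H t) = avg (fun x => H [:: x]).
Proof.
rewrite avg_tupleS; apply: eq_avg => x.
exact: (avg_tuple0 (fun t => H (x :: t))).
Qed.

Lemma avg_tuple2 (T : finType) (H : seq T -> R) :
  avg (fun t : 2.-tuple T => H t) = avg (fun x => avg (fun y => H [:: x; y])).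
Proof.
rewrite avg_tupleS; apply: eq_avg => x.
exact: (avg_tuple1 (fun t => H (x :: t))).
Qed.

(* The edges at one vertex are replaced by [d] one at a time; each of them is
   the only factor depending on both of its endpoints. *)
Lemma star_count X Y (g : X -> Y -> R) d eps b (u : X -> R) (Psi : seq Y -> R) :
  bounded2 g -> `|d| <= 1 -> cut g d eps -> bounded1 u -> bounded1 Psi ->
  `|avg (fun x => avg (fun ys : b.-tuple Y =>
       \prod_(y <- ys) g x y * (u x * Psi ys))) -
    d ^+ b * (avg u * avg (fun ys : b.-tuple Y => Psi ys))| <= eps *+ b.
Proof.
move=> g1 d1 h; have e0 := cut_ge0 h.
elim: b u Psi => [|b IH] u Psi hu hPsi.
  under eq_avg => x do rewrite (avg_tuple0 (fun s => \prod_(y <- s) g x y * (u x * Psi s))).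
  rewrite (avg_tuple0 Psi) expr0 mul1r.
  under eq_avg do rewrite big_nil mul1r.
  by rewrite avgZr subrr normr0 mulr0n.
under eq_avg => x do rewrite (avg_tupleS _ (fun s => \prod_(y <- s) g x y * (u x * Psi s))).
rewrite (avg_tupleS _ Psi) exchange_avg.
set L := avg _; set A := avg (fun y => avg (fun s : b.-tuple Y => _)).
(* For fixed [y] the first summand is the induction hypothesis with weight [g x y * u x]. In the
   second the remaining vertices are averaged out and [cut] replaces the edge to [y]. *)
have -> : L - d ^+ b.+1 * (avg u * A) =
  avg (fun y => avg (fun x => avg (fun s : b.-tuple Y => \prod_(y <- s) g x y *
      (g x y * u x * Psi (y :: s)))) -
    d ^+ b * (avg (fun x => g x y * u x) * avg (fun s : b.-tuple Y => Psi (y :: s)))) +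
  d ^+ b * avg (fun x => avg (fun y => (g x y - d) * u x *
      avg (fun s : b.-tuple Y => Psi (y :: s)))).
  rewrite avgB /L exprS.
  have -> : avg (fun x => avg (fun y => (g x y - d) * u x *
      avg (fun s : b.-tuple Y => Psi (y :: s)))) =
    avg (fun y => avg (fun x => g x y * u x) * avg (fun s : b.-tuple Y => Psi (y :: s)))
    - d * (avg u * A).
    rewrite avg_mul [X in d * X]exchange_avg -avgZ exchange_avg -avgB.
    apply: eq_avg => y; rewrite -avgZr -avgZ -avgB.
    by apply: eq_avg => x; ring.
  rewrite avgZ; set B := avg (fun y => avg (fun x => g x y * u x) * _).
  set C := avg (fun y => avg (fun x => avg _)); set C' := avg (fun y => avg (fun x => avg _)).
  have -> : C = C'.
    apply: eq_avg => y; apply: eq_avg => x; apply: eq_avg => s.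
    by rewrite big_cons; ring.
  ring.
apply: le_trans (ler_normD _ _) _; rewrite mulrSr; apply: lerD.
  apply: norm_avg_le; first by rewrite mulrn_wge0.
  move=> y; apply: (IH (fun x => g x y * u x) (fun s => Psi (y :: s))) => [x|s] //.
  exact: norm_mul_le1.
rewrite normrM -[leRHS]mul1r ler_pM ?norm_exp_le1 //; apply: h => // y.
exact: norm_avg_le1.
Qed.

(** [star_count] is applied first to the edges to the [ys], with those to the [zs] as weight [u],
    and then to the latter with the [ys] averaged out. *)
Lemma double_star_count X Y Z (g : X -> Y -> R) (g' : X -> Z -> R) d d' eps b c
    (Psi : seq Y -> seq Z -> R) :
  (0 < #|X|)%N ->
  bounded2 g -> `|d| <= 1 -> cut g d eps ->
  bounded2 g' -> `|d'| <= 1 -> cut g' d' eps -> bounded2 Psi ->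
  `|avg (fun x => avg (fun ys : b.-tuple Y => avg (fun zs : c.-tuple Z =>
       \prod_(y <- ys) g x y * (\prod_(z <- zs) g' x z * Psi ys zs)))) -
    d ^+ b * d' ^+ c * avg (fun ys : b.-tuple Y => avg (fun zs : c.-tuple Z =>
       Psi ys zs))| <= eps *+ (b + c).
Proof.
move=> X0 g1 d1 h g'1 d'1 h' hPsi; have e0 := cut_ge0 h.
pose B (zs : seq Z) := avg (fun ys : b.-tuple Y => Psi ys zs).
have hB : bounded1 B by move=> zs; apply: norm_avg_le1.
set L := avg _; set A := avg (fun ys => avg _).
have -> : L - d ^+ b * d' ^+ c * A =
  avg (fun zs : c.-tuple Z =>
    avg (fun x => avg (fun ys : b.-tuple Y => \prod_(y <- ys) g x y *
      (\prod_(z <- zs) g' x z * Psi ys zs))) -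
    d ^+ b * (avg (fun x => \prod_(z <- zs) g' x z) * B zs)) +
  d ^+ b * (avg (fun x => avg (fun zs : c.-tuple Z =>
      \prod_(z <- zs) g' x z * (1 * B zs))) -
    d' ^+ c * (avg (fun _ : X => 1) * avg (fun zs : c.-tuple Z => B zs))).
  rewrite avgB avgZ avg_const // mul1r.
  have <- : A = avg (fun zs : c.-tuple Z => B zs) by rewrite /B exchange_avg.
  set C := avg (fun zs => avg _); set D := avg (fun zs => avg _ * _).
  set E := avg (fun x => avg (fun zs => _ * (1 * _))).
  have -> : C = L.
    rewrite /C /L exchange_avg; apply: eq_avg => x; exact: exchange_avg.
  have -> : D = E.
    rewrite /E exchange_avg; apply: eq_avg => zs; rewrite -avgZr.
    by apply: eq_avg => x; rewrite mul1r.
  by ring.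
apply: le_trans (ler_normD _ _) _; rewrite mulrnDr; apply: lerD.
  apply: norm_avg_le => [|zs]; first by rewrite mulrn_wge0.
  apply: (star_count b g1 d1 h (u := fun x => \prod_(z <- zs) g' x z)
    (Psi := fun ys => Psi ys zs)) => [x|ys] //.
  exact: norm_prod_le1.
rewrite normrM -[leRHS]mul1r ler_pM ?norm_exp_le1 //.
by apply: (star_count c g'1 d'1 h' (u := fun=> 1)) => // x; rewrite normr1.
Qed.
End Cut.

(** * Counting complete tripartite configurations *)

Section WeightSystems.
Variables (R : realFieldType) (X1 X2 X3 : finType).
Variables (g12 : X1 -> X2 -> R) (g13 : X1 -> X3 -> R) (g23 : X2 -> X3 -> R).

(* A configuration of already chosen vertices ranges over [Om]; [wM] is the
   indicator that it spans a complete tripartite graph, and [wU], [wV], [wW]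
   are the indicators that a further vertex of X1, X2, X3 is joined to it. *)
Record wsys (Om : finType) := WSys {
  wM : Om -> R; wU : Om -> X1 -> R; wV : Om -> X2 -> R; wW : Om -> X3 -> R }.

Definition wsys0 : wsys unit :=
  WSys (fun=> 1) (fun _ _ => 1) (fun _ _ => 1) (fun _ _ => 1).

(** The factor [wU] joins the new vertex to the old ones; its edges to later vertices are recorded
    in [wV] and [wW]. There are no edges inside [X1], so [wU] itself is unchanged. *)
Definition add1 Om (s : wsys Om) : wsys (Om * X1)%type :=
  WSys (fun o => wM s o.1 * wU s o.1 o.2) (fun o => wU s o.1)
       (fun o y => wV s o.1 y * g12 o.2 y) (fun o z => wW s o.1 z * g13 o.2 z).

Definition add2 Om (s : wsys Om) : wsys (Om * X2)%type :=
  WSys (fun o => wM s o.1 * wV s o.1 o.2) (fun o x => wU s o.1 x * g12 x o.2)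
       (fun o => wV s o.1) (fun o z => wW s o.1 z * g23 o.2 z).

Definition add3 Om (s : wsys Om) : wsys (Om * X3)%type :=
  WSys (fun o => wM s o.1 * wW s o.1 o.2) (fun o x => wU s o.1 x * g13 x o.2)
       (fun o y => wV s o.1 y * g23 y o.2) (fun o => wW s o.1).

(** [Psi] takes lists rather than tuples, so that moving a vertex between the configuration and the
    free vertices needs no casts between lengths. *)
Definition wcount Om (s : wsys Om) a b c (Psi : seq X1 -> seq X2 -> seq X3 -> R) :=
  avg (fun o => avg (fun xs : a.-tuple X1 => avg (fun ys : b.-tuple X2 =>
    avg (fun zs : c.-tuple X3 =>
      wM s o * \prod_(x <- xs) wU s o x * \prod_(y <- ys) wV s o y *
      \prod_(z <- zs) wW s o z * Psi xs ys zs)))).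

Definition tavg a b c (Psi : seq X1 -> seq X2 -> seq X3 -> R) :=
  avg (fun xs : a.-tuple X1 => avg (fun ys : b.-tuple X2 =>
    avg (fun zs : c.-tuple X3 => Psi xs ys zs))).

Variables (p12 p13 p23 eps : R).
Hypotheses (X1_gt0 : (0 < #|X1|)%N) (X2_gt0 : (0 < #|X2|)%N) (X3_gt0 : (0 < #|X3|)%N).
Hypotheses (b12 : bounded2 g12) (b13 : bounded2 g13) (b23 : bounded2 g23).
Hypotheses (p12_le1 : `|p12| <= 1) (p13_le1 : `|p13| <= 1) (p23_le1 : `|p23| <= 1).
Hypotheses (cut12 : cut g12 p12 eps) (cut13 : cut g13 p13 eps) (cut23 : cut g23 p23 eps).

(* [Om] carries n1, n2, n3 chosen vertices, and m12, m13, m23 count the edges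
   having at least one endpoint among them; up to the cut-norm error these
   edges decouple from any bounded [Psi] of the a + b + c further vertices. *)
Definition good n1 n2 n3 Om (s : wsys Om) := forall a b c Psi, bounded3 Psi ->
  let m12 := (n1 * n2 + a * n2 + b * n1)%N in
  let m13 := (n1 * n3 + a * n3 + c * n1)%N in
  let m23 := (n2 * n3 + b * n3 + c * n2)%N in
  `|wcount s a b c Psi - p12 ^+ m12 * p13 ^+ m13 * p23 ^+ m23 * tavg a b c Psi|
    <= eps *+ (m12 + m13 + m23).

Lemma good_wsys0 : good 0 0 0 wsys0.
Proof.
move=> a b c Psi _ /=; rewrite !(mul0n, muln0) !addn0 !expr0 !mul1r mulr0n.
rewrite /wcount avg_unit /= normr_le0 subr_eq0; apply/eqP.
do 3!(apply: eq_avg => ?).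
by rewrite !big1 // !mul1r.
Qed.

(** Two replacements are chained; the first constant is at most 1 in absolute value and does not
    magnify the second error. *)
Lemma good_step (w A T : R) m12 m13 m23 a b c n n' :
  `|w - p12 ^+ m12 * p13 ^+ m13 * p23 ^+ m23 * A| <= eps *+ n ->
  `|A - p12 ^+ a * p13 ^+ b * p23 ^+ c * T| <= eps *+ n' ->
  `|w - p12 ^+ (m12 + a) * p13 ^+ (m13 + b) * p23 ^+ (m23 + c) * T|
     <= eps *+ (n + n').
Proof.
move=> h1 h2; rewrite !exprD.
set P := p12 ^+ m12 * p13 ^+ m13 * p23 ^+ m23 in h1 *.
have hP : `|P| <= 1 by rewrite !norm_mul_le1 ?norm_exp_le1.
have -> : w - p12 ^+ m12 * p12 ^+ a * (p13 ^+ m13 * p13 ^+ b) *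
    (p23 ^+ m23 * p23 ^+ c) * T =
  w - P * A + P * (A - p12 ^+ a * p13 ^+ b * p23 ^+ c * T) by rewrite /P; ring.
apply: le_trans (ler_normD _ _) _; rewrite mulrnDr; apply: lerD => //.
by rewrite normrM -[leRHS]mul1r ler_pM.
Qed.

(** The new vertex is first treated as one more free vertex, with its edges to the other free
    vertices hidden in the test function; [double_star_count] then removes those edges. This is why
    [good] quantifies over all [a], [b], [c] and [Psi]. *)
Lemma good_add1 n1 n2 n3 Om (s : wsys Om) :
  good n1 n2 n3 s -> good n1.+1 n2 n3 (add1 s).
Proof.
move=> h a b c Psi hPsi /=.
(* The value 0 on the empty list only keeps [Psi'] bounded: the averages run over nonempty
   tuples. *)
pose Psi' (xs : seq X1) ys zs := if xs is x :: xs then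
  \prod_(y <- ys) g12 x y * (\prod_(z <- zs) g13 x z * Psi xs ys zs) else 0.
have hPsi' : bounded3 Psi'.
  case=> [|x xs] ys zs /=; first by rewrite normr0.
  by rewrite !norm_mul_le1 // norm_prod_le1.
have := h a.+1 b c Psi' hPsi' => /=.
have -> : wcount s a.+1 b c Psi' = wcount (add1 s) a b c Psi.
  rewrite /wcount avg_pair; apply: eq_avg => o /=.
  rewrite (avg_tupleS _ (fun xs => avg (fun ys : b.-tuple X2 =>
    avg (fun zs : c.-tuple X3 =>
      wM s o * \prod_(x <- xs) wU s o x * \prod_(y <- ys) wV s o y *
      \prod_(z <- zs) wW s o z * Psi' xs ys zs)))).
  do 4!(apply: eq_avg => ?) => /=.
  by rewrite big_cons !big_split /=; ring.
set m12 := (_ * n2 + _ + _)%N; set m13 := (_ * n3 + _ + _)%N; set m23 := (_ + _ + _)%N.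
have -> : tavg a.+1 b c Psi' = avg (fun xs : a.-tuple X1 => avg (fun x =>
   avg (fun ys : b.-tuple X2 => avg (fun zs : c.-tuple X3 =>
    \prod_(y <- ys) g12 x y * (\prod_(z <- zs) g13 x z * Psi xs ys zs))))).
  rewrite /tavg (avg_tupleS _ (fun xs => avg (fun ys : b.-tuple X2 =>
    avg (fun zs : c.-tuple X3 => Psi' xs ys zs)))).
  exact: exchange_avg.
set A := avg _ => h1.
have h2 : `|A - p12 ^+ b * p13 ^+ c * p23 ^+ 0 * tavg a b c Psi| <= eps *+ (b + c).
  rewrite expr0 mulr1 /A /tavg -avgZ -avgB; apply: norm_avg_le => [|xs].
    by rewrite mulrn_wge0 // (cut_ge0 cut12).
  exact: double_star_count.
have -> : (n1.+1 * n2 + a * n2 + b * n1.+1 = m12 + b)%N by rewrite /m12; lia.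
have -> : (n1.+1 * n3 + a * n3 + c * n1.+1 = m13 + c)%N by rewrite /m13; lia.
have -> : (m12 + b + (m13 + c) + m23 = m12 + m13 + m23 + (b + c))%N by lia.
by have := good_step (c := 0) h1 h2; rewrite addn0.
Qed.

Lemma good_add2 n1 n2 n3 Om (s : wsys Om) :
  good n1 n2 n3 s -> good n1 n2.+1 n3 (add2 s).
Proof.
move=> h a b c Psi hPsi /=.
pose Psi' xs (ys : seq X2) zs := if ys is y :: ys then
  \prod_(x <- xs) g12 x y * (\prod_(z <- zs) g23 y z * Psi xs ys zs) else 0.
have hPsi' : bounded3 Psi'.
  move=> xs [|y ys] zs /=; first by rewrite normr0.
  by rewrite !norm_mul_le1 // norm_prod_le1.
have := h a b.+1 c Psi' hPsi' => /=.
have -> : wcount s a b.+1 c Psi' = wcount (add2 s) a b c Psi.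
  rewrite /wcount avg_pair; apply: eq_avg => o /=.
  rewrite [RHS]exchange_avg; apply: eq_avg => xs.
  rewrite (avg_tupleS _ (fun ys => avg (fun zs : c.-tuple X3 =>
      wM s o * \prod_(x <- xs) wU s o x * \prod_(y <- ys) wV s o y *
      \prod_(z <- zs) wW s o z * Psi' xs ys zs))).
  do 3!(apply: eq_avg => ?) => /=.
  by rewrite big_cons !big_split /=; ring.
set m12 := (_ * n2 + _ + _)%N; set m13 := (_ * n3 + _ + _)%N; set m23 := (_ + _ + _)%N.
have -> : tavg a b.+1 c Psi' = avg (fun y => avg (fun xs : a.-tuple X1 =>
   avg (fun zs : c.-tuple X3 => avg (fun ys : b.-tuple X2 =>
    \prod_(x <- xs) g12 x y * (\prod_(z <- zs) g23 y z * Psi xs ys zs))))).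
  rewrite /tavg [RHS]exchange_avg; apply: eq_avg => xs.
  rewrite (avg_tupleS _ (fun ys => avg (fun zs : c.-tuple X3 => Psi' xs ys zs))).
  apply: eq_avg => y; exact: exchange_avg.
set A := avg _ => h1.
have h2 : `|A - p12 ^+ a * p13 ^+ 0 * p23 ^+ c * tavg a b c Psi| <= eps *+ (a + c).
  have e0 := cut_ge0 cut12.
  rewrite expr0 mulr1 /tavg.
  under [X in _ * X]eq_avg do rewrite exchange_avg.
  rewrite /A.
  (* The new vertex has no edges to the [ys], which are averaged out before the double star centred
     at it is counted. *)
  have -> : avg (fun y => avg (fun xs : a.-tuple X1 =>
   avg (fun zs : c.-tuple X3 => avg (fun ys : b.-tuple X2 =>
    \prod_(x <- xs) g12 x y * (\prod_(z <- zs) g23 y z * Psi xs ys zs))))) =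
   avg (fun y => avg (fun xs : a.-tuple X1 =>
   avg (fun zs : c.-tuple X3 =>
    \prod_(x <- xs) g12 x y * (\prod_(z <- zs) g23 y z *
       avg (fun ys : b.-tuple X2 => Psi xs ys zs))))).
    by do 3!(apply: eq_avg => ?); rewrite !avgZ.
  apply: (double_star_count a c
    (Psi := fun xs zs => avg (fun ys : b.-tuple X2 => Psi xs ys zs))
    X2_gt0 _ p12_le1 (cut_sym cut12) b23 p23_le1 cut23) => //.
  by move=> xs ys; apply: norm_avg_le1.
have -> : (n1 * n2.+1 + a * n2.+1 + b * n1 = m12 + a)%N by rewrite /m12; lia.
have -> : (n2.+1 * n3 + b * n3 + c * n2.+1 = m23 + c)%N by rewrite /m23; lia.
have -> : (m12 + a + m13 + (m23 + c) = m12 + m13 + m23 + (a + c))%N by lia.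
by have := good_step (b := 0) h1 h2; rewrite addn0.
Qed.

Lemma good_add3 n1 n2 n3 Om (s : wsys Om) :
  good n1 n2 n3 s -> good n1 n2 n3.+1 (add3 s).
Proof.
move=> h a b c Psi hPsi /=.
pose Psi' xs ys (zs : seq X3) := if zs is z :: zs then
  \prod_(x <- xs) g13 x z * (\prod_(y <- ys) g23 y z * Psi xs ys zs) else 0.
have hPsi' : bounded3 Psi'.
  move=> xs ys [|z zs] /=; first by rewrite normr0.
  by rewrite !norm_mul_le1 // norm_prod_le1.
have := h a b c.+1 Psi' hPsi' => /=.
have -> : wcount s a b c.+1 Psi' = wcount (add3 s) a b c Psi.
  rewrite /wcount avg_pair; apply: eq_avg => o /=.
  rewrite [RHS]exchange_avg; apply: eq_avg => xs.
  rewrite [RHS]exchange_avg; apply: eq_avg => ys.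
  rewrite (avg_tupleS _ (fun zs =>
      wM s o * \prod_(x <- xs) wU s o x * \prod_(y <- ys) wV s o y *
      \prod_(z <- zs) wW s o z * Psi' xs ys zs)).
  do 2!(apply: eq_avg => ?) => /=.
  by rewrite big_cons !big_split /=; ring.
set m12 := (_ * n2 + _ + _)%N; set m13 := (_ * n3 + _ + _)%N; set m23 := (_ + _ + _)%N.
have -> : tavg a b c.+1 Psi' = avg (fun z => avg (fun xs : a.-tuple X1 =>
   avg (fun ys : b.-tuple X2 =>
    \prod_(x <- xs) g13 x z * (\prod_(y <- ys) g23 y z *
      avg (fun zs : c.-tuple X3 => Psi xs ys zs))))).
  rewrite /tavg [RHS]exchange_avg; apply: eq_avg => xs.
  rewrite [RHS]exchange_avg; apply: eq_avg => ys.
  rewrite (avg_tupleS _ (fun zs => Psi' xs ys zs)).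
  by apply: eq_avg => z; rewrite !avgZ.
set A := avg _ => h1.
have h2 : `|A - p12 ^+ 0 * p13 ^+ a * p23 ^+ b * tavg a b c Psi| <= eps *+ (a + b).
  rewrite expr0 mul1r.
  apply: (double_star_count a b
    (Psi := fun xs ys => avg (fun zs : c.-tuple X3 => Psi xs ys zs))
    X3_gt0 _ p13_le1 (cut_sym cut13) _ p23_le1 (cut_sym cut23)) => //.
  by move=> xs ys; apply: norm_avg_le1.
have -> : (n1 * n3.+1 + a * n3.+1 + c * n1 = m13 + a)%N by rewrite /m13; lia.
have -> : (n2 * n3.+1 + b * n3.+1 + c * n2 = m23 + b)%N by rewrite /m23; lia.
have -> : (m12 + (m13 + a) + (m23 + b) = m12 + m13 + m23 + (a + b))%N by lia.
by have := good_step (a := 0) h1 h2; rewrite addn0.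
Qed.
End WeightSystems.

(** * Weighted Gowers-Cauchy-Schwarz *)

Section GowersCauchySchwarz.
Variables (R : realFieldType) (X1 X2 X3 Om : finType).
Variables (g12 : X1 -> X2 -> R) (g13 : X1 -> X3 -> R) (g23 : X2 -> X3 -> R).
Variables (s : wsys R X1 X2 X3 Om) (F : X1 -> X2 -> X3 -> R).
Variables (a : Om -> X1 -> X2 -> R) (b : Om -> X1 -> X3 -> R) (c : Om -> X2 -> X3 -> R).
Hypotheses (g12_ge0 : forall x y, 0 <= g12 x y) (g13_ge0 : forall x z, 0 <= g13 x z)
  (g23_ge0 : forall y z, 0 <= g23 y z).
Hypotheses (M_ge0 : forall o, 0 <= wM s o) (U_ge0 : forall o x, 0 <= wU s o x)
  (V_ge0 : forall o y, 0 <= wV s o y) (W_ge0 : forall o z, 0 <= wW s o z).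
Hypotheses (F12 : forall x y z, F x y z * g12 x y = F x y z)
  (F13 : forall x y z, F x y z * g13 x z = F x y z)
  (F23 : forall x y z, F x y z * g23 y z = F x y z).
Hypotheses (a1 : bounded3 a) (b1 : bounded3 b) (c1 : bounded3 c).

Local Notation M := (wM s).
Local Notation U := (wU s).
Local Notation V := (wV s).
Local Notation W := (wW s).

(** The weight split off by the first Cauchy-Schwarz step, which keeps [x] and [y]. The next two
    counts belong to the steps that keep [x, z0, z1] and [y0, y1, z0, z1]. *)
Definition edge12_count := avg (fun o => avg (fun x => avg (fun y =>
  M o * U o x * V o y * g12 x y))).

Definition cherry13_count := avg (fun o => avg (fun x => avg (fun z0 => avg (fun z1 =>
  M o * U o x * W o z0 * W o z1 * (g13 x z0 * g13 x z1))))).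

Definition square23_count := avg (fun o => avg (fun y0 => avg (fun y1 =>
  avg (fun z0 => avg (fun z1 => M o * V o y0 * V o y1 * W o z0 * W o z1 *
    (g23 y0 z0 * g23 y0 z1 * g23 y1 z0 * g23 y1 z1)))))).

Definition octahedron_avg := avg (fun o => avg (fun x0 => avg (fun x1 =>
  avg (fun y0 => avg (fun y1 => avg (fun z0 => avg (fun z1 =>
    M o * U o x0 * U o x1 * V o y0 * V o y1 * W o z0 * W o z1 *
    (F x0 y0 z0 * F x0 y0 z1 * F x0 y1 z0 * F x0 y1 z1 *
     F x1 y0 z0 * F x1 y0 z1 * F x1 y1 z0 * F x1 y1 z1)))))))).

Definition weighted_avg := avg (fun o => avg (fun x => avg (fun y => avg (fun z =>
  M o * U o x * V o y * W o z * F x y z * (a o x y * b o x z * c o y z))))).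

(** Each step removes one bounded function: [a] by duplicating [z], [b] by duplicating [y], [c] by
    duplicating [x]. Since [F] is supported on the three graphs, the edges among the kept variables
    can be inserted as weights beforehand; without them a power of the density would be lost. *)
Lemma weighted_GCS :
  weighted_avg ^+ 8 <=
  edge12_count ^+ 4 * cherry13_count ^+ 2 * square23_count * octahedron_avg.
Proof.
pose G1 o x y z := W o z * F x y z * b o x z * c o y z.
pose J1 := avg (fun o => avg (fun x => avg (fun y => avg (fun z0 => avg (fun z1 =>
  M o * U o x * V o y * g12 x y * (G1 o x y z0 * G1 o x y z1)))))).
have h1 : weighted_avg ^+ 2 <= edge12_count * J1.
  have -> : weighted_avg = avg (fun o => avg (fun x => avg (fun y => avg (fun z =>
    M o * U o x * V o y * g12 x y * a o x y * G1 o x y z)))).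
    do 4!(apply: eq_avg => ?); rewrite /G1 -[in LHS]F12; ring.
  apply: weighted_CS_dup3 => // o x y; by rewrite !mulr_ge0.
pose G2 o x z0 z1 y := V o y * (F x y z0 * F x y z1) * (c o y z0 * c o y z1).
pose J2 := avg (fun o => avg (fun x => avg (fun z0 => avg (fun z1 =>
  avg (fun y0 => avg (fun y1 => M o * U o x * W o z0 * W o z1 *
    (g13 x z0 * g13 x z1) * (G2 o x z0 z1 y0 * G2 o x z0 z1 y1))))))).
have h2 : J1 ^+ 2 <= cherry13_count * J2.
  have -> : J1 = avg (fun o => avg (fun x => avg (fun z0 => avg (fun z1 => avg (fun y =>
    M o * U o x * W o z0 * W o z1 * (g13 x z0 * g13 x z1) *
    (b o x z0 * b o x z1) * G2 o x z0 z1 y))))).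
    apply: eq_avg => o; apply: eq_avg => x.
    rewrite exchange_avg; apply: eq_avg => z0.
    rewrite exchange_avg; apply: eq_avg => z1; apply: eq_avg => y.
    rewrite /G1 /G2.
    transitivity (M o * U o x * V o y * W o z0 * W o z1 * (F x y z0 * g12 x y) * F x y z1 *
      (b o x z0 * b o x z1 * c o y z0 * c o y z1)); first ring.
    (* The old weight is absorbed into [F], and the next one, the cherry at [x], is drawn from
       it. *)
    rewrite F12 -[in LHS](F13 x y z0) -[in LHS](F13 x y z1); ring.
  apply: weighted_CS_dup4 => [o x y z | o x y z]; first by rewrite !mulr_ge0.
  exact: norm_mul_le1.
pose G3 o y0 y1 z0 z1 x := U o x * (F x y0 z0 * F x y0 z1 * F x y1 z0 * F x y1 z1).
have h3 : J2 ^+ 2 <= square23_count * octahedron_avg.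
  have -> : J2 = avg (fun o => avg (fun y0 => avg (fun y1 => avg (fun z0 => avg (fun z1 =>
    avg (fun x => M o * V o y0 * V o y1 * W o z0 * W o z1 *
    (g23 y0 z0 * g23 y0 z1 * g23 y1 z0 * g23 y1 z1) *
    (c o y0 z0 * c o y0 z1 * c o y1 z0 * c o y1 z1) * G3 o y0 y1 z0 z1 x)))))).
    apply: eq_avg => o.
    transitivity (avg (fun x => avg (fun y0 => avg (fun y1 => avg (fun z0 => avg (fun z1 =>
      M o * U o x * W o z0 * W o z1 * (g13 x z0 * g13 x z1) *
      (G2 o x z0 z1 y0 * G2 o x z0 z1 y1))))))).
      apply: eq_avg => x.
      under eq_avg do rewrite exchange_avg.
      rewrite exchange_avg; apply: eq_avg => y0.
      under eq_avg do rewrite exchange_avg.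
      exact: exchange_avg.
    rewrite exchange_avg; apply: eq_avg => y0.
    rewrite exchange_avg; apply: eq_avg => y1.
    rewrite exchange_avg; apply: eq_avg => z0.
    rewrite exchange_avg; apply: eq_avg => z1; apply: eq_avg => x.
    rewrite /G2 /G3.
    transitivity (M o * U o x * V o y0 * V o y1 * W o z0 * W o z1 *
      ((F x y0 z0 * g13 x z0) * (F x y0 z1 * g13 x z1) * F x y1 z0 * F x y1 z1) *
      (c o y0 z0 * c o y0 z1 * c o y1 z0 * c o y1 z1)); first ring.
    rewrite !F13 -[in LHS](F23 x y0 z0) -[in LHS](F23 x y0 z1).
    rewrite -[in LHS](F23 x y1 z0) -[in LHS](F23 x y1 z1); ring.
  apply: le_trans (weighted_CS_dup5 _ _ _) _.
  - by move=> o y0 y1 z0 z1; rewrite !mulr_ge0.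
  - by move=> o y0 y1 z0 z1; rewrite !norm_mul_le1.
  rewrite le_eqVlt; apply/orP; left; apply/eqP; congr (_ * _).
  apply: eq_avg => o.
  transitivity (avg (fun y0 => avg (fun y1 => avg (fun x0 => avg (fun x1 =>
    avg (fun z0 => avg (fun z1 =>
    M o * U o x0 * U o x1 * V o y0 * V o y1 * W o z0 * W o z1 *
    (F x0 y0 z0 * F x0 y0 z1 * F x0 y1 z0 * F x0 y1 z1 *
     F x1 y0 z0 * F x1 y0 z1 * F x1 y1 z0 * F x1 y1 z1)))))))).
    apply: eq_avg => y0; apply: eq_avg => y1.
    under eq_avg do rewrite exchange_avg.
    rewrite exchange_avg; apply: eq_avg => x0.
    under eq_avg do rewrite exchange_avg.
    rewrite exchange_avg; apply: eq_avg => x1.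
    apply: eq_avg => z0; apply: eq_avg => z1.
    rewrite /G3 -[in RHS](F23 x0 y0 z0) -[in RHS](F23 x0 y0 z1).
    rewrite -[in RHS](F23 x0 y1 z0) -[in RHS](F23 x0 y1 z1); ring.
  under eq_avg do rewrite exchange_avg.
  rewrite exchange_avg; apply: eq_avg => x0.
  under eq_avg do rewrite exchange_avg.
  by rewrite exchange_avg.
have N1 : 0 <= edge12_count by do 3!(apply: avg_ge0 => ?); rewrite !mulr_ge0.
have N2 : 0 <= cherry13_count by do 4!(apply: avg_ge0 => ?); rewrite !mulr_ge0.
have k1 : weighted_avg ^+ 4 <= edge12_count ^+ 2 * (cherry13_count * J2).
  rewrite (exprM _ 2 2); apply: le_trans (_ : (edge12_count * J1) ^+ 2 <= _).
    by rewrite ler_pXn2r ?nnegrE ?sqr_ge0 // (le_trans (sqr_ge0 _) h1).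
  by rewrite exprMn ler_wpM2l ?sqr_ge0.
rewrite (exprM _ 4 2).
apply: le_trans (_ : (edge12_count ^+ 2 * (cherry13_count * J2)) ^+ 2 <= _).
  rewrite ler_pXn2r ?nnegrE ?exprn_even_ge0 //.
  by apply: le_trans k1; rewrite exprn_even_ge0.
have -> : (edge12_count ^+ 2 * (cherry13_count * J2)) ^+ 2 =
  edge12_count ^+ 4 * cherry13_count ^+ 2 * J2 ^+ 2 by ring.
by rewrite -[leRHS]mulrA ler_wpM2l // mulr_ge0 ?exprn_ge0.
Qed.

End GowersCauchySchwarz.

(** Bookkeeping for one of the three graphs: the exponents are its edge numbers in the edge, cherry,
    square and octahedron counts, which occur to the powers 4, 2, 1, 1. *)
Lemma exponent_sum (R : realFieldType) (p : R) l m n r t :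
  (l * 4 + m * 2 + n + r = t * 8)%N ->
  (p ^+ l) ^+ 4 * (p ^+ m) ^+ 2 * p ^+ n * p ^+ r = (p ^+ t) ^+ 8.
Proof. by move=> e; rewrite -(exprM p l 4) -(exprM p m 2) -(exprM p t 8) -e !exprD. Qed.

(** * Averages of a balanced triple function inside a complete tripartite configuration *)

Section Removal.
Variables (R : realFieldType) (X1 X2 X3 : finType).
Variables (g12 : X1 -> X2 -> R) (g13 : X1 -> X3 -> R) (g23 : X2 -> X3 -> R).
Variables (p12 p13 p23 eps eta delta : R).
Hypotheses (X1_gt0 : (0 < #|X1|)%N) (X2_gt0 : (0 < #|X2|)%N) (X3_gt0 : (0 < #|X3|)%N).
Hypotheses (g12_ge0 : forall x y, 0 <= g12 x y) (g13_ge0 : forall x z, 0 <= g13 x z)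
  (g23_ge0 : forall y z, 0 <= g23 y z).
Hypotheses (b12 : bounded2 g12) (b13 : bounded2 g13) (b23 : bounded2 g23).
Hypotheses (p12_01 : 0 < p12 <= 1) (p13_01 : 0 < p13 <= 1) (p23_01 : 0 < p23 <= 1).
Hypotheses (cut12 : cut g12 p12 eps) (cut13 : cut g13 p13 eps) (cut23 : cut g23 p23 eps).

Local Notation q := (p12 * p13 * p23).

Hypotheses (eta_01 : 0 < eta <= 1) (delta_gt0 : 0 < delta)
  (eta_small : eta *+ 256 <= delta ^+ 8) (eps_small : eps *+ 100 <= eta * q ^+ 32).

Variable F : X1 -> X2 -> X3 -> R.
Hypotheses (F12 : forall x y z, F x y z * g12 x y = F x y z)
  (F13 : forall x y z, F x y z * g13 x z = F x y z)
  (F23 : forall x y z, F x y z * g23 y z = F x y z).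
Hypotheses (F_le1 : bounded3 F) (O3F : O3 F <= eta * q ^+ 4).

Variables (Om : finType) (s : wsys R X1 X2 X3 Om) (k : nat).
Hypotheses (M_ge0 : forall o, 0 <= wM s o) (U_ge0 : forall o x, 0 <= wU s o x)
  (V_ge0 : forall o y, 0 <= wV s o y) (W_ge0 : forall o z, 0 <= wW s o z).
Hypotheses (k_le3 : (k <= 3)%N) (good_s : good p12 p13 p23 eps k k k s).

Lemma monomial_ge0 a b c : 0 <= p12 ^+ a * p13 ^+ b * p23 ^+ c.
Proof.
by move: p12_01 p13_01 p23_01 => /andP[? ?] /andP[? ?] /andP[? ?];
  rewrite !mulr_ge0 ?exprn_ge0 ?ltW.
Qed.

Lemma monomial_ge a b c : (a <= 32)%N -> (b <= 32)%N -> (c <= 32)%N ->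
  q ^+ 32 <= p12 ^+ a * p13 ^+ b * p23 ^+ c.
Proof.
have [/andP[/ltW a0 a1] /andP[/ltW b0 b1] /andP[/ltW c0 c1]] :=
  And3 p12_01 p13_01 p23_01.
move=> ha hb hc; rewrite !exprMn; apply: ler_pM; rewrite ?mulr_ge0 ?exprn_ge0 //.
  by apply: ler_pM; rewrite ?exprn_ge0 //; apply: ler_wiXn2l.
exact: ler_wiXn2l.
Qed.

(** For [k <= 3] each count below has at most 25 edges between two classes and makes at most 63
    cut-norm replacements; 32 and 100 are round bounds for these. *)
Lemma eps_mul_le m a b c : (m <= 100)%N -> (a <= 32)%N -> (b <= 32)%N -> (c <= 32)%N ->
  eps *+ m <= eta * (p12 ^+ a * p13 ^+ b * p23 ^+ c).
Proof.
move=> hm ha hb hc; have e0 := cut_ge0 cut12.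
apply: le_trans (_ : eps *+ 100 <= _); first exact: ler_wpMn2l.
apply: le_trans eps_small _; rewrite ler_wpM2l ?monomial_ge //.
by case/andP: eta_01 => /ltW.
Qed.

Lemma eps_mul_le1 m a b c : (m <= 100)%N -> (a <= 32)%N -> (b <= 32)%N -> (c <= 32)%N ->
  eps *+ m <= p12 ^+ a * p13 ^+ b * p23 ^+ c.
Proof.
move=> hm ha hb hc; apply: le_trans (eps_mul_le hm ha hb hc) _.
rewrite ler_piMl //; last by case/andP: eta_01.
exact: monomial_ge0.
Qed.

Lemma norm_le1_01 (p : R) : 0 < p <= 1 -> `|p| <= 1.
Proof. by case/andP => p0 p1; rewrite gtr0_norm. Qed.

Let n12 := norm_le1_01 p12_01.
Let n13 := norm_le1_01 p13_01.
Let n23 := norm_le1_01 p23_01.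

(** The edges at the configuration give the monomial with exponents [a], [b], [c], those among the
    free vertices the factor [t]. Both errors together are at most the full monomial, hence the
    factor 2. *)
Lemma count_le (w A t : R) m m' a b c i j l :
  `|w - p12 ^+ a * p13 ^+ b * p23 ^+ c * A| <= eps *+ m ->
  `|A - t| <= eps *+ m' -> t = p12 ^+ i * p13 ^+ j * p23 ^+ l ->
  (a + i <= 32)%N -> (b + j <= 32)%N -> (c + l <= 32)%N -> (m + m' <= 100)%N ->
  w <= (p12 ^+ (a + i) * p13 ^+ (b + j) * p23 ^+ (c + l)) *+ 2.
Proof.
set P := p12 ^+ a * p13 ^+ b * p23 ^+ c => hw hA ht ha hb hc hm.
have P01 : 0 <= P <= 1.
  have := @norm_mul_le1 R (p12 ^+ a * p13 ^+ b) (p23 ^+ c).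
  have P0 : 0 <= P.
    exact: monomial_ge0.
  by rewrite P0 -/P (ger0_norm P0); apply; rewrite ?norm_mul_le1 ?norm_exp_le1.
have e0 := cut_ge0 cut12.
have := eps_mul_le1 hm ha hb hc; rewrite !exprD.
have -> : p12 ^+ a * p12 ^+ i * (p13 ^+ b * p13 ^+ j) * (p23 ^+ c * p23 ^+ l) = P * t.
  by rewrite ht /P; ring.
have hPA : P * (A - t) <= eps *+ m'.
  case/andP: P01 => P0 P1; apply: le_trans (_ : P * (eps *+ m') <= _).
    by rewrite ler_wpM2l // (le_trans (ler_norm _)).
  by rewrite ler_piMl // mulrn_wge0.
move: (le_trans (ler_norm _) hw); rewrite mulrnDr mulr2n.
by lra.
Qed.

(** The exponents keep the shape given by [good] at [a, b, c = 1, 1, 0], followed by the number of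
    edges among the free vertices; likewise in the next bounds. *)
Lemma edge12_bound : edge12_count g12 s <=
  p12 ^+ (k * k + 1 * k + 1 * k + 1) * p13 ^+ (k * k + 1 * k + 0 * k + 0) *
  p23 ^+ (k * k + 1 * k + 0 * k + 0) *+ 2.
Proof.
pose Psi (xs : seq X1) (ys : seq X2) (zs : seq X3) : R :=
  if (xs, ys) is ([:: x], [:: y]) then g12 x y else 0.
have hPsi : bounded3 Psi.
  by move=> [|x [|? ?]] [|y [|? ?]] zs; rewrite /Psi ?normr0 //; exact: b12.
have := good_s 1 1 0 hPsi => /=.
have -> : wcount s 1 1 0 Psi = edge12_count g12 s.
  rewrite /wcount; apply: eq_avg => o.
  rewrite (avg_tuple1 (fun xs => avg (fun ys : 1.-tuple X2 => avg (fun zs : 0.-tuple X3 =>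
    wM s o * \prod_(x <- xs) wU s o x * \prod_(y <- ys) wV s o y *
      \prod_(z <- zs) wW s o z * Psi xs ys zs)))); apply: eq_avg => x.
  rewrite (avg_tuple1 (fun ys => avg (fun zs : 0.-tuple X3 =>
    wM s o * \prod_(x <- [:: x]) wU s o x * \prod_(y <- ys) wV s o y *
      \prod_(z <- zs) wW s o z * Psi [:: x] ys zs))); apply: eq_avg => y.
  rewrite (avg_tuple0 (fun zs =>
    wM s o * \prod_(x <- [:: x]) wU s o x * \prod_(y <- [:: y]) wV s o y *
      \prod_(z <- zs) wW s o z * Psi [:: x] [:: y] zs)).
  by rewrite !big_seq1 big_nil mulr1.
have -> : tavg 1 1 0 Psi = avg (fun x => avg (g12 x)).
  rewrite /tavg (avg_tuple1 (fun xs => avg (fun ys : 1.-tuple X2 =>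
    avg (fun zs : 0.-tuple X3 => Psi xs ys zs)))); apply: eq_avg => x.
  rewrite (avg_tuple1 (fun ys => avg (fun zs : 0.-tuple X3 => Psi [:: x] ys zs))).
  apply: eq_avg => y; exact: (avg_tuple0 (fun zs => Psi [:: x] [:: y] zs)).
move=> h; apply: (count_le (m' := 1) (i := 1) (j := 0) (l := 0) h (cut_dens X1_gt0 X2_gt0 cut12)).
  by rewrite expr1 !expr0 !mulr1.
all: by case: (k) k_le3 => [|[|[|[|?]]]].
Qed.

Lemma cherry13_bound : cherry13_count g13 s <=
  p12 ^+ (k * k + 1 * k + 0 * k + 0) * p13 ^+ (k * k + 1 * k + 2 * k + 2) *
  p23 ^+ (k * k + 0 * k + 2 * k + 0) *+ 2.
Proof.
pose Psi (xs : seq X1) (ys : seq X2) (zs : seq X3) : R :=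
  if (xs, zs) is ([:: x], [:: z0; z1]) then g13 x z0 * g13 x z1 else 0.
have hPsi : bounded3 Psi.
  by move=> [|x [|? ?]] ys [|z0 [|z1 [|? ?]]] ; rewrite /Psi ?normr0 // !norm_mul_le1 //.
have := good_s 1 0 2 hPsi => /=.
have -> : wcount s 1 0 2 Psi = cherry13_count g13 s.
  rewrite /wcount; apply: eq_avg => o.
  rewrite (avg_tuple1 (fun xs => avg (fun ys : 0.-tuple X2 => avg (fun zs : 2.-tuple X3 =>
    wM s o * \prod_(x <- xs) wU s o x * \prod_(y <- ys) wV s o y *
      \prod_(z <- zs) wW s o z * Psi xs ys zs)))); apply: eq_avg => x.
  rewrite (avg_tuple0 (fun ys => avg (fun zs : 2.-tuple X3 =>
    wM s o * \prod_(x <- [:: x]) wU s o x * \prod_(y <- ys) wV s o y *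
      \prod_(z <- zs) wW s o z * Psi [:: x] ys zs))).
  rewrite (avg_tuple2 (fun zs =>
    wM s o * \prod_(x <- [:: x]) wU s o x * \prod_(y <- [::]) wV s o y *
      \prod_(z <- zs) wW s o z * Psi [:: x] [::] zs)).
  apply: eq_avg => z0; apply: eq_avg => z1.
  by rewrite !big_cons !big_nil /Psi; ring.
have -> : tavg 1 0 2 Psi = avg (fun x => avg (fun z0 => avg (fun z1 => g13 x z0 * g13 x z1))).
  rewrite /tavg (avg_tuple1 (fun xs => avg (fun ys : 0.-tuple X2 =>
    avg (fun zs : 2.-tuple X3 => Psi xs ys zs)))); apply: eq_avg => x.
  rewrite (avg_tuple0 (fun ys => avg (fun zs : 2.-tuple X3 => Psi [:: x] ys zs))).
  exact: (avg_tuple2 (fun zs => Psi [:: x] [::] zs)).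
have b31 : bounded2 (fun z x => g13 x z) by move=> z x.
have hc := cut_sym (cut_dbl_left b31 n13 (cut_sym cut13)).
have P3_gt0 : (0 < #|{: X3 * X3}|)%N by rewrite card_prod muln_gt0 X3_gt0.
have := cut_dens X1_gt0 P3_gt0 hc; under eq_avg do rewrite avg_pair /=.
move=> hd h; apply: (count_le (i := 0) (j := 2) (l := 0) h hd).
  by rewrite !expr0 mul1r mulr1.
all: by case: (k) k_le3 => [|[|[|[|?]]]].
Qed.

Lemma square23_bound : square23_count g23 s <=
  p12 ^+ (k * k + 0 * k + 2 * k + 0) * p13 ^+ (k * k + 0 * k + 2 * k + 0) *
  p23 ^+ (k * k + 2 * k + 2 * k + 4) *+ 2.
Proof.
pose Psi (xs : seq X1) (ys : seq X2) (zs : seq X3) : R :=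
  if (ys, zs) is ([:: y0; y1], [:: z0; z1]) then
    g23 y0 z0 * g23 y0 z1 * g23 y1 z0 * g23 y1 z1 else 0.
have hPsi : bounded3 Psi.
  by move=> xs [|y0 [|y1 [|? ?]]] [|z0 [|z1 [|? ?]]] ; rewrite /Psi ?normr0 // !norm_mul_le1 //.
have := good_s 0 2 2 hPsi => /=.
have -> : wcount s 0 2 2 Psi = square23_count g23 s.
  rewrite /wcount; apply: eq_avg => o.
  rewrite (avg_tuple0 (fun xs => avg (fun ys : 2.-tuple X2 => avg (fun zs : 2.-tuple X3 =>
    wM s o * \prod_(x <- xs) wU s o x * \prod_(y <- ys) wV s o y *
      \prod_(z <- zs) wW s o z * Psi xs ys zs)))).
  rewrite (avg_tuple2 (fun ys => avg (fun zs : 2.-tuple X3 =>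
    wM s o * \prod_(x <- [::]) wU s o x * \prod_(y <- ys) wV s o y *
      \prod_(z <- zs) wW s o z * Psi [::] ys zs))).
  apply: eq_avg => y0; apply: eq_avg => y1.
  rewrite (avg_tuple2 (fun zs =>
    wM s o * \prod_(x <- [::]) wU s o x * \prod_(y <- [:: y0; y1]) wV s o y *
      \prod_(z <- zs) wW s o z * Psi [::] [:: y0; y1] zs)).
  apply: eq_avg => z0; apply: eq_avg => z1.
  by rewrite big_nil !big_cons !big_nil /Psi; ring.
have -> : tavg 0 2 2 Psi = avg (fun p : X2 * X2 => avg (dbl g23 p)).
  rewrite /tavg (avg_tuple0 (fun xs => avg (fun ys : 2.-tuple X2 =>
    avg (fun zs : 2.-tuple X3 => Psi xs ys zs)))).
  rewrite (avg_tuple2 (fun ys => avg (fun zs : 2.-tuple X3 => Psi [::] ys zs))).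
  rewrite avg_pair; apply: eq_avg => y0; apply: eq_avg => y1.
  by rewrite (avg_tuple2 (fun zs => Psi [::] [:: y0; y1] zs)) avg_pair.
have P2_gt0 : (0 < #|{: X2 * X2}|)%N by rewrite card_prod muln_gt0 X2_gt0.
have P3_gt0 : (0 < #|{: X3 * X3}|)%N by rewrite card_prod muln_gt0 X3_gt0.
move=> h; apply: (count_le (i := 0) (j := 0) (l := 4) h
  (cut_dens P2_gt0 P3_gt0 (cut_dbl b23 n23 cut23))).
  by rewrite !expr0 !mul1r.
all: by case: (k) k_le3 => [|[|[|[|?]]]].
Qed.

(** Here the main term carries the factor [eta] from [O3F], so the graph error has to be below [eta]
    times the monomial; this is the reason for [eta] in [eps_small]. *)
Lemma octahedron_bound : octahedron_avg s F <=
  eta * (p12 ^+ (k * k + 2 * k + 2 * k + 4) * p13 ^+ (k * k + 2 * k + 2 * k + 4) *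
  p23 ^+ (k * k + 2 * k + 2 * k + 4)) *+ 2.
Proof.
pose Psi (xs : seq X1) (ys : seq X2) (zs : seq X3) : R :=
  if (xs, ys, zs) is ([:: x0; x1], [:: y0; y1], [:: z0; z1]) then
    F x0 y0 z0 * F x0 y0 z1 * F x0 y1 z0 * F x0 y1 z1 *
    F x1 y0 z0 * F x1 y0 z1 * F x1 y1 z0 * F x1 y1 z1 else 0.
have hPsi : bounded3 Psi.
  move=> [|x0 [|x1 [|? ?]]] [|y0 [|y1 [|? ?]]] [|z0 [|z1 [|? ?]]] ;
  by rewrite /Psi ?normr0 // !norm_mul_le1.
have := good_s 2 2 2 hPsi => /=.
have -> : wcount s 2 2 2 Psi = octahedron_avg s F.
  rewrite /wcount; apply: eq_avg => o.
  rewrite (avg_tuple2 (fun xs => avg (fun ys : 2.-tuple X2 => avg (fun zs : 2.-tuple X3 =>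
    wM s o * \prod_(x <- xs) wU s o x * \prod_(y <- ys) wV s o y *
      \prod_(z <- zs) wW s o z * Psi xs ys zs)))).
  apply: eq_avg => x0; apply: eq_avg => x1.
  rewrite (avg_tuple2 (fun ys => avg (fun zs : 2.-tuple X3 =>
    wM s o * \prod_(x <- [:: x0; x1]) wU s o x * \prod_(y <- ys) wV s o y *
      \prod_(z <- zs) wW s o z * Psi [:: x0; x1] ys zs))).
  apply: eq_avg => y0; apply: eq_avg => y1.
  rewrite (avg_tuple2 (fun zs =>
    wM s o * \prod_(x <- [:: x0; x1]) wU s o x * \prod_(y <- [:: y0; y1]) wV s o y *
      \prod_(z <- zs) wW s o z * Psi [:: x0; x1] [:: y0; y1] zs)).
  apply: eq_avg => z0; apply: eq_avg => z1.
  by rewrite !big_cons !big_nil /Psi; ring.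
have -> : tavg 2 2 2 Psi = O3 F.
  rewrite /tavg (avg_tuple2 (fun xs => avg (fun ys : 2.-tuple X2 =>
    avg (fun zs : 2.-tuple X3 => Psi xs ys zs)))).
  apply: eq_avg => x0; apply: eq_avg => x1.
  rewrite (avg_tuple2 (fun ys => avg (fun zs : 2.-tuple X3 => Psi [:: x0; x1] ys zs))).
  apply: eq_avg => y0; apply: eq_avg => y1.
  rewrite (avg_tuple2 (fun zs => Psi [:: x0; x1] [:: y0; y1] zs)).
  apply: eq_avg => z0; apply: eq_avg => z1.
  by rewrite /Psi !big_bool /sel /=; ring.
set a := (k * k + 2 * k + 2 * k)%N => h.
have ha : (a + 4 <= 32)%N by rewrite /a; case: (k) k_le3 => [|[|[|[|?]]]].
have ham : (a + a + a <= 100)%N by rewrite /a; case: (k) k_le3 => [|[|[|[|?]]]].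
have := eps_mul_le ham ha ha ha; move: (le_trans (ler_norm _) h).
clearbody a; rewrite !exprD; set P := p12 ^+ a * p13 ^+ a * p23 ^+ a.
have P0 : 0 <= P := monomial_ge0 a a a.
have := ler_wpM2l P0 O3F.
have -> : p12 ^+ a * p12 ^+ 4 * (p13 ^+ a * p13 ^+ 4) * (p23 ^+ a * p23 ^+ 4) =
  P * q ^+ 4 by rewrite /P; ring.
rewrite mulr2n; lra.
Qed.

(** [q ^+ (k.+1 * k.+1)] is the expected density of complete tripartite configurations with k + 1
    vertices in each class, so [delta] is a relative error. The comparison is made between eighth
    powers. *)
Lemma weighted_avg_bound (a : Om -> X1 -> X2 -> R) (b : Om -> X1 -> X3 -> R)
    (c : Om -> X2 -> X3 -> R) : bounded3 a -> bounded3 b -> bounded3 c ->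
  `|weighted_avg s F a b c| <= delta * q ^+ (k.+1 * k.+1).
Proof.
move=> a1 b1 c1; have [[p0 _] [p0' _] [p0'' _]] :=
  And3 (andP p12_01) (andP p13_01) (andP p23_01).
have q0 : 0 <= q by rewrite !mulr_ge0 ?ltW.
have := weighted_GCS g12_ge0 g13_ge0 g23_ge0 M_ge0 U_ge0 V_ge0 W_ge0
  F12 F13 F23 a1 b1 c1.
set J := weighted_avg _ _ _ _ _ => h.
have r0 : 0 <= delta * q ^+ (k.+1 * k.+1) by rewrite mulr_ge0 ?exprn_ge0 // ltW.
rewrite -(@ler_pXn2r _ 8) ?nnegrE //.
rewrite -normrX ger0_norm ?exprn_even_ge0 //; apply: le_trans h _.
have N1 : 0 <= edge12_count g12 s by do 3!(apply: avg_ge0 => ?); rewrite !mulr_ge0.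
have N2 : 0 <= cherry13_count g13 s by do 4!(apply: avg_ge0 => ?); rewrite !mulr_ge0.
have N3 : 0 <= square23_count g23 s by do 5!(apply: avg_ge0 => ?); rewrite !mulr_ge0.
have := edge12_bound; have := cherry13_bound; have := square23_bound.
have := octahedron_bound.
set A4 := (_ * _) => h4; set A3 := _ * _ => h3; set A2 := _ * _ => h2; set A1 := _ * _ => h1.
have A4_ge0 : 0 <= A4.
  by apply: mulr_ge0; [case/andP: eta_01 => /ltW | exact: monomial_ge0].
(* Each count is at most twice its main term, and 2^4 * 2^2 * 2 * 2 = 256 is the constant in
   [eta_small]. *)
apply: le_trans (_ : (A1 *+ 2) ^+ 4 * (A2 *+ 2) ^+ 2 * (A3 *+ 2) * (A4 *+ 2) <= _).
  apply: le_trans (_ : edge12_count g12 s ^+ 4 * cherry13_count g13 s ^+ 2 *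
    square23_count g23 s * (A4 *+ 2) <= _).
    apply: ler_wpM2l => //.
    by apply: mulr_ge0 => //; apply: mulr_ge0; apply: exprn_ge0.
  rewrite ler_wpM2r ?mulrn_wge0 //.
  apply: ler_pM => //; first by apply: mulr_ge0; apply: exprn_ge0.
  by apply: ler_pM; rewrite ?exprn_ge0 // lerXn2r ?nnegrE ?mulrn_wge0 ?monomial_ge0.
have -> : (A1 *+ 2) ^+ 4 * (A2 *+ 2) ^+ 2 * (A3 *+ 2) * (A4 *+ 2) =
  eta *+ 256 * (q ^+ (k.+1 * k.+1)) ^+ 8.
  have e12 := @exponent_sum R p12 (k * k + 1 * k + 1 * k + 1) (k * k + 1 * k + 0 * k + 0)
    (k * k + 0 * k + 2 * k + 0) (k * k + 2 * k + 2 * k + 4) (k.+1 * k.+1).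
  have e13 := @exponent_sum R p13 (k * k + 1 * k + 0 * k + 0) (k * k + 1 * k + 2 * k + 2)
    (k * k + 0 * k + 2 * k + 0) (k * k + 2 * k + 2 * k + 4) (k.+1 * k.+1).
  have e23 := @exponent_sum R p23 (k * k + 1 * k + 0 * k + 0) (k * k + 0 * k + 2 * k + 0)
    (k * k + 2 * k + 2 * k + 4) (k * k + 2 * k + 2 * k + 4) (k.+1 * k.+1).
  rewrite (exprMn _ (p12 * p13)) (exprMn _ p12).
  rewrite (exprMn 8 (_ * _)) (exprMn 8 (p12 ^+ _)) -e12 -?e13 -?e23;
    try by case: (k) k_le3 => [|[|[|[|?]]]].
  by rewrite /A1 /A2 /A3 /A4; ring.
by rewrite [leRHS]exprMn ler_wpM2r ?exprn_ge0.
Qed.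

End Removal.

(** * The doubled complex *)

Section Layer.
Variables (R : realFieldType) (X1 X2 X3 : finType).
Variables (g12 : X1 -> X2 -> R) (g13 : X1 -> X3 -> R) (g23 : X2 -> X3 -> R).
Variables (f : X1 -> X2 -> X3 -> R) (p12 p13 p23 d eps eta delta : R).
Hypotheses (X1_gt0 : (0 < #|X1|)%N) (X2_gt0 : (0 < #|X2|)%N) (X3_gt0 : (0 < #|X3|)%N).
Hypotheses (g12_ge0 : forall x y, 0 <= g12 x y) (g13_ge0 : forall x z, 0 <= g13 x z)
  (g23_ge0 : forall y z, 0 <= g23 y z).
Hypotheses (b12 : bounded2 g12) (b13 : bounded2 g13) (b23 : bounded2 g23).
Hypotheses (g12_idem : forall x y, g12 x y * g12 x y = g12 x y)
  (g13_idem : forall x z, g13 x z * g13 x z = g13 x z)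
  (g23_idem : forall y z, g23 y z * g23 y z = g23 y z).
Hypotheses (p12_01 : 0 < p12 <= 1) (p13_01 : 0 < p13 <= 1) (p23_01 : 0 < p23 <= 1).
Hypotheses (cut12 : cut g12 p12 eps) (cut13 : cut g13 p13 eps) (cut23 : cut g23 p23 eps).

Local Notation q := (p12 * p13 * p23).

Hypotheses (eta_01 : 0 < eta <= 1) (delta_gt0 : 0 < delta)
  (eta_small : eta *+ 256 <= delta ^+ 8) (eps_small : eps *+ 100 <= eta * q ^+ 32).

Definition tri x y z := g12 x y * g13 x z * g23 y z.
Definition bal x y z := f x y z - d * tri x y z.

Hypotheses (f_le1 : bounded3 f) (d_le1 : `|d| <= 1) (bal_le1 : bounded3 bal).
Hypotheses (f12 : forall x y z, f x y z * g12 x y = f x y z)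
  (f13 : forall x y z, f x y z * g13 x z = f x y z)
  (f23 : forall x y z, f x y z * g23 y z = f x y z).
Hypotheses (O3_bal : O3 bal <= eta * q ^+ 4).

Lemma tri_le1 : bounded3 tri.
Proof. by move=> x y z; rewrite !norm_mul_le1. Qed.

Lemma tri12 x y z : tri x y z * g12 x y = tri x y z.
Proof. by rewrite /tri -[in RHS]g12_idem; ring. Qed.
Lemma tri13 x y z : tri x y z * g13 x z = tri x y z.
Proof. by rewrite /tri -[in RHS]g13_idem; ring. Qed.
Lemma tri23 x y z : tri x y z * g23 y z = tri x y z.
Proof. by rewrite /tri -[in RHS]g23_idem; ring. Qed.

Lemma bal12 x y z : bal x y z * g12 x y = bal x y z.
Proof. by rewrite /bal mulrBl f12 -mulrA tri12. Qed.
Lemma bal13 x y z : bal x y z * g13 x z = bal x y z.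
Proof. by rewrite /bal mulrBl f13 -mulrA tri13. Qed.
Lemma bal23 x y z : bal x y z * g23 y z = bal x y z.
Proof. by rewrite /bal mulrBl f23 -mulrA tri23. Qed.

Definition selp (T : Type) (e : bool) (p : T * T) := sel e p.1 p.2.
(** Places [x] at position [e] and its partner [x'] at the other; with [avg_mkp] this reduces the
    eight choices of a selected triple to one computation. *)
Definition mkp (T : Type) (e : bool) (x x' : T) := if e then (x', x) else (x, x').

Lemma selp_mkp (T : Type) e (x x' : T) : selp e (mkp e x x') = x.
Proof. by case: e. Qed.
Lemma selp_mkpN (T : Type) e (x x' : T) : selp (~~ e) (mkp e x x') = x'.
Proof. by case: e. Qed.

Lemma avg_mkp (T : finType) e (G : T * T -> R) :
  avg G = avg (fun x' => avg (fun x => G (mkp e x x'))).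
Proof. by rewrite avg_pair; case: e => //; rewrite exchange_avg. Qed.

Lemma mul_mkp (T : Type) (u : T -> R) e x x' :
  u (mkp e x x').1 * u (mkp e x x').2 = u x * u x'.
Proof. by case: e; rewrite // mulrC. Qed.

Lemma dbl_mkp (S T : finType) (g : S -> T -> R) e e' x x' y y' :
  dbl g (mkp e x x') (mkp e' y y') = g x y * g x y' * g x' y * g x' y'.
Proof. by rewrite /dbl; case: e; case: e' => /=; ring. Qed.

Definition prod8 (h : X1 -> X2 -> X3 -> R) (p : X1 * X1) (q : X2 * X2) (r : X3 * X3) :=
  h p.1 q.1 r.1 * h p.1 q.1 r.2 * h p.1 q.2 r.1 * h p.1 q.2 r.2 *
  h p.2 q.1 r.1 * h p.2 q.1 r.2 * h p.2 q.2 r.1 * h p.2 q.2 r.2.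

Definition tri2 (p : X1 * X1) (q : X2 * X2) (r : X3 * X3) :=
  dbl g12 p q * dbl g13 p r * dbl g23 q r.

(** Each of the twelve edges of an octahedron lies in two of its eight triangles; idempotence merges
    the two occurrences. *)
Lemma prod8_tri p q r : prod8 tri p q r = tri2 p q r.
Proof.
case: p q r => [x x'] [y y'] [z z']; rewrite /prod8 /tri2 /dbl /tri /=.
rewrite -[in RHS](g12_idem x y) -[in RHS](g12_idem x y') -[in RHS](g12_idem x' y).
rewrite -[in RHS](g12_idem x' y').
rewrite -[in RHS](g13_idem x z) -[in RHS](g13_idem x z') -[in RHS](g13_idem x' z).
rewrite -[in RHS](g13_idem x' z').
rewrite -[in RHS](g23_idem y z) -[in RHS](g23_idem y z') -[in RHS](g23_idem y' z).
rewrite -[in RHS](g23_idem y' z').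
ring.
Qed.

(* The factor at the vertices selected by [e], the seven others being [h]. *)
Definition term8 (h : bool -> bool -> bool -> X1 -> X2 -> X3 -> R) (e1 e2 e3 : bool)
    (p : X1 * X1) (q : X2 * X2) (r : X3 * X3) :=
  let H t1 t2 t3 := h t1 t2 t3 (selp t1 p) (selp t2 q) (selp t3 r) in
  bal (selp e1 p) (selp e2 q) (selp e3 r) *
  (H e1 e2 (~~ e3) * H e1 (~~ e2) e3 * H (~~ e1) e2 e3 * H e1 (~~ e2) (~~ e3) *
   H (~~ e1) e2 (~~ e3) * H (~~ e1) (~~ e2) e3 * H (~~ e1) (~~ e2) (~~ e3)).

(* Triples are ordered by the binary number t1 t2 t3: those before [e] carry
   [f], those after it carry the model [d * tri]. *)
Definition telescope_factor (e1 e2 e3 t1 t2 t3 : bool) x y z :=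
  if (t1 * 4 + t2 * 2 + t3 < e1 * 4 + e2 * 2 + e3)%N then f x y z else d * tri x y z.

(** Consecutive hybrid products differ in a single factor, [f] against [d * tri], and the difference
    of these is [bal]. *)
Lemma prod8_telescope p q r :
  prod8 f p q r - d ^+ 8 * tri2 p q r =
  \sum_(e1 : bool) \sum_(e2 : bool) \sum_(e3 : bool)
    term8 (telescope_factor e1 e2 e3) e1 e2 e3 p q r.
Proof.
rewrite -prod8_tri !big_bool /term8 /telescope_factor /selp /sel /bal /prod8 /=.
ring.
Qed.

Variables (Om : finType) (s : wsys R X1 X2 X3 Om) (k : nat).
Hypotheses (M_ge0 : forall o, 0 <= wM s o) (U_ge0 : forall o x, 0 <= wU s o x)
  (V_ge0 : forall o y, 0 <= wV s o y) (W_ge0 : forall o z, 0 <= wW s o z).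
Hypotheses (k_le2 : (k <= 2)%N) (good_s : good p12 p13 p23 eps k k k s).

Definition pair_weight o (p : X1 * X1) (q : X2 * X2) (r : X3 * X3) :=
  wM s o * (wU s o p.1 * wU s o p.2) * (wV s o q.1 * wV s o q.2) *
  (wW s o r.1 * wW s o r.2).

(* The partners of the selected vertices join the configuration, so that
   everything except the factor [bal] splits into functions of two of the
   selected vertices. *)
Lemma term8_bound h e1 e2 e3 a b c :
  (forall t1 t2 t3, bounded3 (h t1 t2 t3)) -> bounded3 a -> bounded3 b -> bounded3 c ->
  `|avg (fun o => avg (fun p => avg (fun q => avg (fun r =>
     pair_weight o p q r * tri2 p q r * term8 h e1 e2 e3 p q r *
     (a o p q * b o p r * c o q r)))))| <= delta * q ^+ (k.+2 * k.+2).
Proof.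
move=> h1 a1 b1 c1.
pose s1 := add3 g13 g23 (add2 g12 g23 (add1 g12 g13 s)).
have n12 := norm_le1_01 p12_01; have n13 := norm_le1_01 p13_01.
have n23 := norm_le1_01 p23_01.
have good1 : good p12 p13 p23 eps k.+1 k.+1 k.+1 s1.
  by apply: good_add3 => //; apply: good_add2 => //; apply: good_add1.
(* Each of the seven factors other than [bal] misses a selected vertex. Those missing [z] go into
   [A], those missing [y] but not [z] into [B], and the one missing only [x] into [C]. *)
pose A (o : Om * X1 * X2 * X3) x y :=
  let: (o, x', y', z') := o in
  a o (mkp e1 x x') (mkp e2 y y') * (h e1 e2 (~~ e3) x y z' *
  h e1 (~~ e2) (~~ e3) x y' z' * h (~~ e1) e2 (~~ e3) x' y z' *
  h (~~ e1) (~~ e2) (~~ e3) x' y' z').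
pose B (o : Om * X1 * X2 * X3) x z :=
  let: (o, x', y', z') := o in
  b o (mkp e1 x x') (mkp e3 z z') * (h e1 (~~ e2) e3 x y' z *
  h (~~ e1) (~~ e2) e3 x' y' z).
pose C (o : Om * X1 * X2 * X3) y z :=
  let: (o, x', y', z') := o in
  c o (mkp e2 y y') (mkp e3 z z') * h (~~ e1) e2 e3 x' y z.
have -> : avg (fun o => avg (fun p => avg (fun q => avg (fun r =>
     pair_weight o p q r * tri2 p q r * term8 h e1 e2 e3 p q r *
     (a o p q * b o p r * c o q r))))) = weighted_avg s1 bal A B C.
  rewrite /weighted_avg !avg_pair; apply: eq_avg => o.
  rewrite (avg_mkp e1); apply: eq_avg => x'.
  under eq_avg do rewrite (avg_mkp e2).
  rewrite exchange_avg; apply: eq_avg => y'.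
  under eq_avg do under eq_avg do rewrite (avg_mkp e3).
  under eq_avg do rewrite exchange_avg.
  rewrite exchange_avg; apply: eq_avg => z'.
  apply: eq_avg => x; apply: eq_avg => y; apply: eq_avg => z.
  rewrite /pair_weight /tri2 /term8 !dbl_mkp !selp_mkp !selp_mkpN.
  rewrite (mul_mkp (wU s o)) (mul_mkp (wV s o)) (mul_mkp (wW s o)) /A /B /C /=.
  (* Nine of the twelve edges of [tri2] are in the weights of [s1]; the three inside the selected
     triple are supplied by [bal]. *)
  rewrite -[in RHS](bal12 x y z) -[in RHS](bal13 x y z) -[in RHS](bal23 x y z).
  ring.
apply: (weighted_avg_bound X1_gt0 X2_gt0 X3_gt0 g12_ge0 g13_ge0 g23_ge0 b12 b13 b23
  p12_01 p13_01 p23_01 cut12 cut13 cut23 eta_01 delta_gt0 eta_small eps_small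
  bal12 bal13 bal23 bal_le1 O3_bal _ _ _ _ _ good1) => //.
- by move=> o; rewrite /= !mulr_ge0.
- by move=> o x; rewrite /= !mulr_ge0.
- by move=> o y; rewrite /= !mulr_ge0.
- by move=> o z; rewrite /= !mulr_ge0.
- by move=> [[[o x'] y'] z'] x y; rewrite !norm_mul_le1 // h1.
- by move=> [[[o x'] y'] z'] x z; rewrite !norm_mul_le1 // h1.
- by move=> [[[o x'] y'] z'] y z; rewrite !norm_mul_le1 // h1.
Qed.

Lemma tri2_idem p q r : tri2 p q r * tri2 p q r = tri2 p q r.
Proof.
rewrite -prod8_tri /prod8.
have e x y z : tri x y z * tri x y z = tri x y z.
  by rewrite {2}/tri !mulrA tri12 tri13 tri23.
rewrite -[in RHS](e p.1 q.1 r.1) -[in RHS](e p.1 q.1 r.2) -[in RHS](e p.1 q.2 r.1).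
rewrite -[in RHS](e p.1 q.2 r.2) -[in RHS](e p.2 q.1 r.1) -[in RHS](e p.2 q.1 r.2).
rewrite -[in RHS](e p.2 q.2 r.1) -[in RHS](e p.2 q.2 r.2).
ring.
Qed.

Lemma tri2_prod8 p q r : tri2 p q r * prod8 f p q r = prod8 f p q r.
Proof.
rewrite -prod8_tri /prod8.
have e x y z : f x y z * tri x y z = f x y z.
  by rewrite /tri !mulrA f12 f13 f23.
rewrite -[in RHS](e p.1 q.1 r.1) -[in RHS](e p.1 q.1 r.2) -[in RHS](e p.1 q.2 r.1).
rewrite -[in RHS](e p.1 q.2 r.2) -[in RHS](e p.2 q.1 r.1) -[in RHS](e p.2 q.1 r.2).
rewrite -[in RHS](e p.2 q.2 r.1) -[in RHS](e p.2 q.2 r.2).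
ring.
Qed.

Lemma prod8_bal_bound a b c : bounded3 a -> bounded3 b -> bounded3 c ->
  `|avg (fun o => avg (fun p => avg (fun q => avg (fun r =>
     pair_weight o p q r * (prod8 f p q r - d ^+ 8 * tri2 p q r) *
     (a o p q * b o p r * c o q r)))))| <= delta * q ^+ (k.+2 * k.+2) *+ 8.
Proof.
move=> a1 b1 c1.
pose E e1 e2 e3 := avg (fun o => avg (fun p => avg (fun q => avg (fun r =>
     pair_weight o p q r * tri2 p q r *
     term8 (telescope_factor e1 e2 e3) e1 e2 e3 p q r *
     (a o p q * b o p r * c o q r))))).
have -> : avg (fun o => avg (fun p => avg (fun q => avg (fun r =>
     pair_weight o p q r * (prod8 f p q r - d ^+ 8 * tri2 p q r) *
     (a o p q * b o p r * c o q r))))) =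
  \sum_(e1 : bool) \sum_(e2 : bool) \sum_(e3 : bool) E e1 e2 e3.
  rewrite !big_bool /= /E -!avgD; apply: eq_avg => o.
  rewrite -!avgD; apply: eq_avg => p; rewrite -!avgD; apply: eq_avg => q.
  rewrite -!avgD; apply: eq_avg => r.
  (* Both terms are supported on [tri2], so the factor [tri2] required by [term8_bound] can be
     inserted. *)
  have -> : prod8 f p q r - d ^+ 8 * tri2 p q r =
    tri2 p q r * (prod8 f p q r - d ^+ 8 * tri2 p q r).
    by rewrite mulrBr tri2_prod8 [tri2 p q r * (_ * _)]mulrCA tri2_idem.
  rewrite prod8_telescope !big_bool /=; ring.
have hE e1 e2 e3 : `|E e1 e2 e3| <= delta * q ^+ (k.+2 * k.+2).
  apply: term8_bound => // t1 t2 t3 x y z; rewrite /telescope_factor.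
  by case: ifP => // _; rewrite norm_mul_le1 // tri_le1.
rewrite !big_bool /=.
have lerD2 (u v B : R) n m : `|u| <= B *+ n -> `|v| <= B *+ m -> `|u + v| <= B *+ (n + m).
  by move=> hu hv; apply: le_trans (ler_normD _ _) _; rewrite mulrnDr lerD.
by apply: (lerD2 _ _ _ 4 4); apply: (lerD2 _ _ _ 2 2); apply: (lerD2 _ _ _ 1 1).
Qed.

End Layer.

(** * Indicator functions and regularity of the doubled graphs *)

Section Indicators.
Variable R : realFieldType.

Lemma bool_ge0 (b : bool) : 0 <= (b : nat)%:R :> R. Proof. exact: ler0n. Qed.

Lemma bool_norm (b : bool) : `|(b : nat)%:R| <= 1 :> R.
Proof. by case: b; rewrite ?normr1 ?normr0. Qed.

Lemma bool_idem (b : bool) : (b : nat)%:R * (b : nat)%:R = (b : nat)%:R :> R.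
Proof. by case: b; rewrite ?mulr1 ?mulr0. Qed.

Lemma bool_and (b c : bool) : ((b && c : bool) : nat)%:R = (b : nat)%:R * (c : nat)%:R :> R.
Proof. by case: b; rewrite ?mul1r ?mul0r. Qed.

Lemma forall_bool (P : pred bool) : [forall b, P b] = P false && P true.
Proof. by apply/forallP/andP => [h|[h0 h1] [|]]; rewrite ?h. Qed.

Lemma dens_avg (X Y : finType) (g : X -> Y -> bool) :
  dens R g = avg (fun x => avg (fun y => (g x y : nat)%:R)).
Proof. by rewrite /dens /avg -mulr_suml natrM invfM -mulrA [_^-1 * _]mulrC. Qed.

Lemma dens_01 (X Y : finType) (g : X -> Y -> bool) : 0 <= dens R g <= 1.
Proof.
rewrite dens_avg; apply/andP; split; first by do 2!(apply: avg_ge0 => ?); exact: bool_ge0.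
by do 2!(apply: avg_le_const => // ?); case: (g _ _).
Qed.

(** By the convention 1/0 = 0 an empty class would make the density 0. *)
Lemma dens_gt0_card (X Y : finType) (g : X -> Y -> bool) :
  0 < dens R g -> (0 < #|X|)%N && (0 < #|Y|)%N.
Proof. by rewrite /dens -muln_gt0; case: posnP => // ->; rewrite invr0 mulr0 ltxx. Qed.

(** Common form of [aux12], [aux13] and [aux23], which are convertible to instances of it. *)
Definition pair_graph (X Y : finType) (g : X -> Y -> bool) (p : X * X) (q : Y * Y) :=
  [forall s : bool, forall t : bool, g (sel s p.1 p.2) (sel t q.1 q.2)].

Lemma pair_graph_dbl (X Y : finType) (g : X -> Y -> bool) p q :
  (pair_graph g p q : nat)%:R = dbl (fun x y => (g x y : nat)%:R : R) p q.
Proof. by rewrite /pair_graph !forall_bool /dbl /sel /= !bool_and; ring. Qed.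

(** The doubled graph is within [eps *+ 4] of [dens R g ^+ 4] in cut norm; recentring at its own
    density costs as much again, hence [eps *+ 8]. *)
Lemma pair_graph_regular (X Y : finType) (g : X -> Y -> bool) eps :
  (0 < #|X|)%N -> (0 < #|Y|)%N ->
  cut (fun x y => (g x y : nat)%:R : R) (dens R g) eps ->
  `|dens R (pair_graph g) - dens R g ^+ 4| <= eps *+ 4 /\
  forall eta, eps *+ 8 < eta -> graph_qr eta (pair_graph g).
Proof.
move=> X0 Y0 h; have /andP[d0 d1] := dens_01 g; have e0 := cut_ge0 h.
have b1 : bounded2 (fun x y => (g x y : nat)%:R : R) by move=> x y; exact: bool_norm.
have h4 : cut (fun p q => (pair_graph g p q : nat)%:R : R) (dens R g ^+ 4) (eps *+ 4).
  move=> u v hu hv; have := cut_dbl b1 _ h hu hv; rewrite ger0_norm // => /(_ d1).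
  congr (`|_| <= _); do 2!(apply: eq_avg => ?); by rewrite pair_graph_dbl.
have hd : `|dens R (pair_graph g) - dens R g ^+ 4| <= eps *+ 4.
  by rewrite dens_avg; apply: cut_dens => //; rewrite card_prod muln_gt0 ?X0 ?Y0.
split=> // eta lt; apply: graph_qr_of_cut lt (dens_01 _) _.
rewrite (mulrnDr eps 4 4); apply: cut_recenter h4; first exact: mulrn_wge0.
by rewrite distrC.
Qed.

End Indicators.

Definition avg3 (R : realFieldType) (X1 X2 X3 : finType) (F : X1 -> X2 -> X3 -> R) :=
  avg (fun x => avg (fun y => avg (fun z => F x y z))).

Lemma eq_avg3 (R : realFieldType) (X1 X2 X3 : finType) (F G : X1 -> X2 -> X3 -> R) :
  (forall x y z, F x y z = G x y z) -> avg3 F = avg3 G.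
Proof. by move=> e; do 3!(apply: eq_avg => ?). Qed.

Lemma d123_avg3 (R : realFieldType) (X1 X2 X3 : finType) (H : cplx X1 X2 X3) :
  (0 < #|X1|)%N -> (0 < #|X2|)%N -> (0 < #|X3|)%N ->
  d123 R H = avg3 (fun x y z => (c123 H x y z : nat)%:R) /
             avg3 (fun x y z => (star H x y z : nat)%:R).
Proof.
move=> X1_gt0 X2_gt0 X3_gt0.
have e (F : X1 -> X2 -> X3 -> R) : avg3 F =
    (\sum_x \sum_y \sum_z F x y z) / (#|X3|%:R * #|X2|%:R * #|X1|%:R).
  rewrite /avg3 /avg; under eq_bigr => x _ do rewrite -mulr_suml.
  by rewrite -!mulr_suml !invfM !mulrA.
rewrite !e; set N : R := #|X3|%:R * #|X2|%:R * #|X1|%:R.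
have N0 : N != 0 by rewrite /N -!natrM pnatr_eq0 -lt0n !muln_gt0 X1_gt0 X2_gt0 X3_gt0.
by clearbody N; rewrite invfM invrK mulrACA mulVf // mulr1.
Qed.

Lemma d123_01 (R : realFieldType) (X1 X2 X3 : finType) (H : cplx X1 X2 X3) :
  is_complex H -> 0 <= d123 R H <= 1.
Proof.
move=> cH; rewrite /d123; set A := (X in X / _); set B := (X in _ / X).
have A0 : 0 <= A by do 3!(apply: sumr_ge0 => ? _); exact: ler0n.
have AB : A <= B.
  do 3!(apply: ler_sum => ? _); rewrite ler_nat.
  by case E: (c123 _ _ _ _); rewrite // (cH _ _ _ E).
have B0 := le_trans A0 AB; rewrite divr_ge0 //=.
have [->|Bn] := eqVneq B 0; first by rewrite invr0 mulr0.
by rewrite ler_pdivrMr ?mul1r // lt_neqAle eq_sym Bn.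
Qed.

(** * The auxiliary complex: relative density and octahedral average *)

Section AuxiliaryComplex.
Variables (R : realFieldType) (X1 X2 X3 : finType) (H : cplx X1 X2 X3).
Hypothesis complexH : is_complex H.

Local Notation p12 := (d12 R H).
Local Notation p13 := (d13 R H).
Local Notation p23 := (d23 R H).
Local Notation dH := (d123 R H).
Local Notation dA := (d123 R (aux H)).
Local Notation q := (p12 * p13 * p23).
Local Notation g12 := (fun x y => (c12 H x y : nat)%:R : R).
Local Notation g13 := (fun x z => (c13 H x z : nat)%:R : R).
Local Notation g23 := (fun y z => (c23 H y z : nat)%:R : R).
Local Notation f := (fun x y z => (c123 H x y z : nat)%:R : R).
Local Notation T2 := (tri2 g12 g13 g23).

Lemma star_tri x y z : (star H x y z : nat)%:R = tri g12 g13 g23 x y z.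
Proof. by rewrite /star !bool_and mulrA. Qed.

Lemma star_aux_tri2 p u r : (star (aux H) p u r : nat)%:R = T2 p u r.
Proof. by rewrite /star !bool_and mulrA /= !pair_graph_dbl. Qed.

(** In a complex the eight triples already force the pair conditions of [aux123]: each pair extends
    to a triple by an arbitrary choice of the third vertex. *)
Lemma aux123_prod8 p u r : (aux123 H p u r : nat)%:R = prod8 f p u r.
Proof.
have -> : aux123 H p u r = [forall e1 : bool, forall e2 : bool, forall e3 : bool,
    c123 H (sel e1 p.1 p.2) (sel e2 u.1 u.2) (sel e3 r.1 r.2)].
  apply/idP/idP => [/and4P[]//|h]; apply/and4P; split=> //.
  - apply/forallP => s; apply/forallP => t.
    by move/forallP/(_ s)/forallP/(_ t)/forallP/(_ true)/complexH/and3P: h => [].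
  - apply/forallP => s; apply/forallP => t.
    by move/forallP/(_ s)/forallP/(_ true)/forallP/(_ t)/complexH/and3P: h => [].
  - apply/forallP => s; apply/forallP => t.
    by move/forallP/(_ true)/forallP/(_ s)/forallP/(_ t)/complexH/and3P: h => [].
by rewrite !forall_bool /sel /= !bool_and /prod8; ring.
Qed.

Lemma aux_complex : is_complex (aux H).
Proof. by move=> p u r /and4P[h1 h2 h3 _]; apply/and3P. Qed.

Variables (eps eta delta : R).
Hypotheses (X1_gt0 : (0 < #|X1|)%N) (X2_gt0 : (0 < #|X2|)%N) (X3_gt0 : (0 < #|X3|)%N).
Hypotheses (p12_01 : 0 < p12 <= 1) (p13_01 : 0 < p13 <= 1) (p23_01 : 0 < p23 <= 1).
Hypotheses (cut12 : cut g12 p12 eps) (cut13 : cut g13 p13 eps) (cut23 : cut g23 p23 eps).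
Hypotheses (eta_01 : 0 < eta <= 1) (delta_gt0 : 0 < delta)
  (eta_small : eta *+ 256 <= delta ^+ 8) (eps_small : eps *+ 100 <= eta * q ^+ 32).
Hypothesis tri_qrH : tri_qr eta H.

Let b12 : bounded2 g12. Proof. by move=> x y; exact: bool_norm. Qed.
Let b13 : bounded2 g13. Proof. by move=> x y; exact: bool_norm. Qed.
Let b23 : bounded2 g23. Proof. by move=> x y; exact: bool_norm. Qed.
Let P1_gt0 : (0 < #|{: X1 * X1}|)%N. Proof. by rewrite card_prod muln_gt0 X1_gt0. Qed.
Let P2_gt0 : (0 < #|{: X2 * X2}|)%N. Proof. by rewrite card_prod muln_gt0 X2_gt0. Qed.
Let P3_gt0 : (0 < #|{: X3 * X3}|)%N. Proof. by rewrite card_prod muln_gt0 X3_gt0. Qed.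
Let n12 := norm_le1_01 p12_01.
Let n13 := norm_le1_01 p13_01.
Let n23 := norm_le1_01 p23_01.
Let q_gt0 : 0 < q.
Proof.
case/andP: p12_01 => h12 _; case/andP: p13_01 => h13 _; case/andP: p23_01 => h23 _.
exact: mulr_gt0 (mulr_gt0 h12 h13) h23.
Qed.
Let q_le1 : q <= 1.
Proof.
have := @norm_mul_le1 R (p12 * p13) p23 (norm_mul_le1 n12 n13) n23.
by rewrite gtr0_norm.
Qed.
Let dH_01 : 0 <= dH <= 1 := d123_01 R complexH.

Lemma eps_le_q (m : nat) : (m <= 32)%N -> eps *+ 100 <= q ^+ m.
Proof.
move=> hm; apply: le_trans eps_small _; apply: le_trans (_ : q ^+ 32 <= _).
  by rewrite ler_piMl ?exprn_ge0 ?(ltW q_gt0) //; case/andP: eta_01.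
by apply: ler_wiXn2l => //; exact: ltW.
Qed.

Lemma bal_norm : bounded3 (bal g12 g13 g23 f dH).
Proof.
move=> x y z; rewrite /bal -star_tri ler_norml; have /andP[d0 d1] := dH_01.
by case: (c123 _ _ _ _); case: (star _ _ _ _); rewrite /= ?mulr1 ?mulr0; lra.
Qed.

Lemma f_mul (x : X1) (y : X2) (z : X3) : [/\ f x y z * g12 x y = f x y z,
  f x y z * g13 x z = f x y z & f x y z * g23 y z = f x y z].
Proof.
have e (b : bool) : (c123 H x y z -> b) ->
    (c123 H x y z : nat)%:R * (b : nat)%:R = (c123 H x y z : nat)%:R :> R.
  by rewrite -bool_and; case: (c123 H x y z) => // ->.
by split; apply: e => /complexH/and3P[].
Qed.

Lemma O3_bal_le : O3 (bal g12 g13 g23 f dH) <= eta * q ^+ 4.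
Proof.
apply: ltW; move: tri_qrH; rewrite /tri_qr; congr (_ < _).
do 6!(apply: eq_avg => ?); do 3!(apply: eq_bigr => ? _).
by rewrite /bal star_tri.
Qed.

Lemma prod8_bound (Om : finType) (s : wsys R X1 X2 X3 Om) (k : nat) a b c :
  (forall o, 0 <= wM s o) -> (forall o x, 0 <= wU s o x) ->
  (forall o y, 0 <= wV s o y) -> (forall o z, 0 <= wW s o z) ->
  (k <= 2)%N -> good p12 p13 p23 eps k k k s ->
  bounded3 a -> bounded3 b -> bounded3 c ->
  `|avg (fun o => avg3 (fun p u r =>
     pair_weight s o p u r * (prod8 f p u r - dH ^+ 8 * T2 p u r) *
     (a o p u * b o p r * c o u r)))| <= delta * q ^+ (k.+2 * k.+2) *+ 8.
Proof.
move=> *; apply: (prod8_bal_bound (f := f) X1_gt0 X2_gt0 X3_gt0 _ _ _ b12 b13 b23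
  (fun x y => bool_idem R _) (fun x y => bool_idem R _) (fun x y => bool_idem R _)
  p12_01 p13_01 p23_01 cut12 cut13 cut23 eta_01 delta_gt0 eta_small
  eps_small _ _ bal_norm _ _ _ O3_bal_le) => //.
- by move=> x y z; exact: bool_norm.
- by case/andP: dH_01 => d0 d1; rewrite ger0_norm.
- by move=> x y z; case: (f_mul x y z).
- by move=> x y z; case: (f_mul x y z).
- by move=> x y z; case: (f_mul x y z).
Qed.

Lemma T2_count u v w : bounded1 u -> bounded1 v -> bounded1 w ->
  `|avg3 (fun p s r => T2 p s r * (u p * v s * w r)) - q ^+ 4 * (avg u * avg v * avg w)|
    <= eps *+ 12.
Proof.
move=> hu hv hw; rewrite (mulrnA eps 4 3).
have -> : q ^+ 4 = p12 ^+ 4 * p13 ^+ 4 * p23 ^+ 4 by ring.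
apply: triangle_count => //; rewrite ?norm_exp_le1 //; try exact: cut_dbl.
all: by move=> p s; rewrite /dbl !norm_mul_le1.
Qed.

(** The case [k = 0] of the empty configuration; [u] and [v] are put into the function of [p, s],
    and [w] into that of [p, r]. *)
Lemma prod8_count u v w : bounded1 u -> bounded1 v -> bounded1 w ->
  `|avg3 (fun p s r => prod8 f p s r * (u p * v s * w r)) -
    dH ^+ 8 * avg3 (fun p s r => T2 p s r * (u p * v s * w r))|
    <= delta * q ^+ 4 *+ 8.
Proof.
move=> hu hv hw.
have A1 : bounded3 (fun (_ : unit) p s => u p * v s) by move=> _ p s; rewrite norm_mul_le1.
have B1 : bounded3 (fun (_ : unit) (_ : X1 * X1) r => w r) by move=> _ _ r.
have C1 : bounded3 (fun (_ : unit) (_ : X2 * X2) (_ : X3 * X3) => 1 : R).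
  by move=> *; rewrite normr1.
have := @prod8_bound _ (wsys0 R X1 X2 X3) 0 _ _ _ (fun=> ler01)
  (fun _ _ => ler01) (fun _ _ => ler01)
  (fun _ _ => ler01) isT (good_wsys0 (X1 := X1) (X2 := X2) (X3 := X3) p12 p13 p23 eps) A1 B1 C1.
rewrite avg_unit; congr (`|_| <= _).
rewrite /avg3 -avgZ -avgB; apply: eq_avg => p; rewrite -avgZ -avgB.
apply: eq_avg => s; rewrite -avgZ -avgB; apply: eq_avg => r.
by rewrite /pair_weight /=; ring.
Qed.

(** The density of [H'] is a quotient whose denominator is at least half of [q ^+ 4], which turns
    the error [delta * q ^+ 4 *+ 8] of the numerator into [delta *+ 16]. *)
Lemma dens_aux_close : `|dA - dH ^+ 8| <= delta *+ 16.
Proof.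
have one (T : Type) : bounded1 (fun _ : T => 1 : R) by move=> t; rewrite normr1.
have := T2_count (one _) (one _) (one _).
have := prod8_count (one _) (one _) (one _).
rewrite !avg_const //.
have -> : avg3 (fun p s r => T2 p s r * (1 * 1 * 1)) = avg3 T2.
  by apply: eq_avg3 => p s r; rewrite !mulr1.
have -> : avg3 (fun p s r => prod8 f p s r * (1 * 1 * 1)) = avg3 (prod8 f).
  by apply: eq_avg3 => p s r; rewrite !mulr1.
rewrite !mulr1; have -> : dA = avg3 (prod8 f) / avg3 T2.
  rewrite d123_avg3 //; congr (_ / _); apply: eq_avg3 => p s r.
    by rewrite -aux123_prod8.
  by rewrite -star_aux_tri2.
set A := avg3 _; set T := avg3 _ => hA hT.
have := eps_le_q (isT : (4 <= 32)%N) => he.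
have Q0 : 0 < q ^+ 4 by rewrite exprn_gt0.
have e0 := cut_ge0 cut12.
have T_ge : q ^+ 4 <= T *+ 2.
  by move: hT; rewrite ler_norml => /andP[hT _]; lra.
have T_gt0 : 0 < T by lra.
have -> : A / T - dH ^+ 8 = (A - dH ^+ 8 * T) / T by rewrite mulrBl mulfK ?gt_eqF.
rewrite normrM normfV (gtr0_norm T_gt0) ler_pdivrMr //; apply: le_trans hA _.
have := ler_wpM2l (ltW delta_gt0) T_ge; lra.
Qed.

Local Notation D12 := (dbl g12).
Local Notation D13 := (dbl g13).
Local Notation D23 := (dbl g23).

Definition aux_bal p u r := prod8 f p u r - dA * T2 p u r.

Lemma dbl_idem (S T : finType) (g : S -> T -> bool) p u :
  let D := dbl (fun x y => (g x y : nat)%:R : R) in D p u * D p u = D p u.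
Proof. by rewrite /= -pair_graph_dbl bool_idem. Qed.

Lemma aux_bal_norm p u r : `|aux_bal p u r| <= T2 p u r.
Proof.
rewrite /aux_bal -aux123_prod8 -star_aux_tri2.
have /andP[d0 d1] := d123_01 R aux_complex.
have := @aux_complex p u r; rewrite /=; case: (aux123 _ _ _ _).
  by move=> -> //=; rewrite mulr1 ger0_norm; lra.
move=> _; case: (star _ _ _ _); last by rewrite mulr0 subrr normr0.
by rewrite sub0r mulr1 normrN ger0_norm.
Qed.

Lemma T2_mul p u r :
  [/\ T2 p u r * D12 p u = T2 p u r, T2 p u r * D13 p r = T2 p u r &
      T2 p u r * D23 u r = T2 p u r].
Proof.
have e (a b c : R) : a * a = a -> [/\ a * b * c * a = a * b * c,
    b * a * c * a = b * a * c & b * c * a * a = b * c * a].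
  by move=> h; split; rewrite -[in RHS]h; ring.
rewrite /tri2; split.
- by case: (e _ (D13 p r) (D23 u r) (dbl_idem (c12 H) p u)).
- by case: (e _ (D12 p u) (D23 u r) (dbl_idem (c13 H) p r)).
- by case: (e _ (D12 p u) (D13 p r) (dbl_idem (c23 H) u r)).
Qed.

(** Where [T2] vanishes so does [aux_bal]; elsewhere a factor that preserves [T2] must equal 1. *)
Lemma aux_bal_mul p u r :
  [/\ aux_bal p u r * D12 p u = aux_bal p u r,
      aux_bal p u r * D13 p r = aux_bal p u r &
      aux_bal p u r * D23 u r = aux_bal p u r].
Proof.
have e D : T2 p u r * D = T2 p u r -> aux_bal p u r * D = aux_bal p u r.
  move=> h; have [T0|T1] := eqVneq (T2 p u r) 0.
    have := aux_bal_norm p u r; rewrite T0 normr_le0 => /eqP ->.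
    by rewrite mul0r.
  have -> : D = 1 by apply: (mulfI T1); rewrite h mulr1.
  by rewrite mulr1.
by have [h1 h2 h3] := T2_mul p u r; split; apply: e.
Qed.

Lemma aux_bal_le1 p u r : `|aux_bal p u r| <= 1.
Proof.
apply: le_trans (aux_bal_norm p u r) _.
by rewrite -star_aux_tri2; case: (star _ _ _ _).
Qed.

(** Doubling twice gives complete tripartite configurations with four vertices in each class, so 16
    edges between any two classes; the factor 2 absorbs the cut-norm error. *)
Lemma double_dbl_count :
  avg (fun P => avg (fun U => avg (fun Q =>
    dbl D12 P U * dbl D13 P Q * dbl D23 U Q))) <= q ^+ 16 *+ 2.
Proof.
have one (T : Type) : bounded1 (fun _ : T => 1 : R) by move=> t; rewrite normr1.
have bd (X Y : finType) (g : X -> Y -> R) : bounded2 g -> bounded2 (dbl g).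
  by move=> h p u; rewrite /dbl !norm_mul_le1.
have PP (X : finType) : (0 < #|X|)%N -> (0 < #|{: (X * X) * (X * X)}|)%N.
  by move=> h; rewrite !card_prod !muln_gt0 h.
have cc (X Y : finType) (g : X -> Y -> R) p : bounded2 g -> `|p| <= 1 -> cut g p eps ->
    cut (dbl (dbl g)) (p ^+ 4 ^+ 4) (eps *+ 16).
  move=> hb hp h; rewrite (mulrnA eps 4 4).
  by apply: cut_dbl; [exact: bd | exact: norm_exp_le1 | exact: cut_dbl].
have := triangle_count (bd _ _ _ (bd _ _ _ b12)) (bd _ _ _ (bd _ _ _ b13))
  (bd _ _ _ (bd _ _ _ b23)) (norm_exp_le1 4 (norm_exp_le1 4 n12))
  (norm_exp_le1 4 (norm_exp_le1 4 n13)) (norm_exp_le1 4 (norm_exp_le1 4 n23))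
  (cc _ _ _ _ b12 n12 cut12) (cc _ _ _ _ b13 n13 cut13) (cc _ _ _ _ b23 n23 cut23)
  (one _) (one _) (one _).
rewrite !avg_const ?PP // !mulr1.
under eq_avg do under eq_avg do under eq_avg do rewrite !mulr1.
have -> : p12 ^+ 4 ^+ 4 * p13 ^+ 4 ^+ 4 * p23 ^+ 4 ^+ 4 = q ^+ 16 by ring.
set A := avg _ => h; have := eps_le_q (isT : (16 <= 32)%N) => he.
have e0 := cut_ge0 cut12.
by move: h; rewrite ler_norml => /andP[_ h]; lra.
Qed.

(** One doubled vertex of each class forms the configuration, so [k = 2], and only [aux_bal p u r]
    is split, into [prod8 f - dH ^+ 8 * T2] and [(dH ^+ 8 - dA) * T2]. The parts contribute 8 and 16
    * 2 to the constant 40. *)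
Lemma O3_aux_bound : O3 aux_bal <= delta * q ^+ 16 *+ 40.
Proof.
pose Om := (unit * X1 * X1 * X2 * X2 * X3 * X3)%type.
pose s2 : wsys R X1 X2 X3 Om := add3 g13 g23 (add3 g13 g23 (add2 g12 g23 (add2 g12 g23
  (add1 g12 g13 (add1 g12 g13 (wsys0 R X1 X2 X3)))))).
have good2 : good p12 p13 p23 eps 2 2 2 s2.
  do 2!(apply: good_add3 => //); do 2!(apply: good_add2 => //).
  by do 2!(apply: good_add1 => //); exact: good_wsys0.
have avg_Om (G : Om -> R) : avg G = avg (fun p1 : X1 * X1 => avg (fun u1 : X2 * X2 =>
    avg (fun r1 : X3 * X3 => G (tt, p1.1, p1.2, u1.1, u1.2, r1.1, r1.2)))).
  rewrite !avg_pair avg_unit; do 2!(apply: eq_avg => ?); rewrite avg_pair.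
  by do 2!(apply: eq_avg => ?); rewrite avg_pair.
pose P1 (o : Om) := (o.1.1.1.1.1.2, o.1.1.1.1.2).
pose U1 (o : Om) := (o.1.1.1.2, o.1.1.2).
pose R1 (o : Om) := (o.1.2, o.2).
pose a o p u := aux_bal p u (R1 o) * aux_bal p (U1 o) (R1 o).
pose b o p r := aux_bal p (U1 o) r * aux_bal (P1 o) (U1 o) r.
pose c o u r := aux_bal (P1 o) u r * aux_bal (P1 o) u (R1 o) *
  aux_bal (P1 o) (U1 o) (R1 o).
have a1 : bounded3 a by move=> o p u; rewrite !norm_mul_le1 ?aux_bal_le1.
have b1 : bounded3 b by move=> o p r; rewrite !norm_mul_le1 ?aux_bal_le1.
have c1 : bounded3 c by move=> o u r; rewrite !norm_mul_le1 ?aux_bal_le1.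
have weightE o p u r : pair_weight s2 o p u r =
    (D12 p (U1 o) * D23 (U1 o) r) * (D12 (P1 o) u * D13 (P1 o) r) *
    (D13 p (R1 o) * D23 u (R1 o)) *
    (D12 (P1 o) (U1 o) * D13 (P1 o) (R1 o) * D23 (U1 o) (R1 o)).
  by case: o => [[[[[[[] ?] ?] ?] ?] ?] ?]; rewrite /pair_weight /dbl /=; ring.
have O3E : O3 aux_bal = avg (fun o : Om => avg3 (fun p u r =>
    aux_bal p u r * (a o p u * b o p r * c o u r))).
  rewrite avg_Om /O3 exchange_avg; apply: eq_avg => p1.
  under eq_avg do rewrite exchange_avg.
  rewrite exchange_avg; apply: eq_avg => u1.
  under eq_avg do under eq_avg do rewrite exchange_avg.
  under eq_avg do rewrite exchange_avg.
  rewrite exchange_avg; apply: eq_avg => r1.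
  do 3!(apply: eq_avg => ?); rewrite !big_bool /sel /=.
  by case: p1 u1 r1 => ? ? [? ?] [? ?]; rewrite /a /b /c /P1 /U1 /R1 /=; ring.
(* The other seven factors already force every edge outside the expanded doubled triple, so the
   weight of [s2] can be inserted without changing the product. *)
have absorb o p u r : pair_weight s2 o p u r * (a o p u * b o p r * c o u r) =
    a o p u * b o p r * c o u r.
  have [h1 _ h2] := aux_bal_mul p (U1 o) r; have [h3 h4 _] := aux_bal_mul (P1 o) u r.
  have [_ h5 h6] := aux_bal_mul p u (R1 o).
  have [h7 h8 h9] := aux_bal_mul (P1 o) (U1 o) (R1 o).
  rewrite weightE /a /b /c.
  rewrite -[in RHS]h9 -[in RHS]h8 -[in RHS]h7 -[in RHS]h6 -[in RHS]h5.
  rewrite -[in RHS]h4 -[in RHS]h3 -[in RHS]h2 -[in RHS]h1; ring.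
have s2_ge0 : [/\ forall o, 0 <= wM s2 o, forall o x, 0 <= wU s2 o x,
    forall o y, 0 <= wV s2 o y & forall o z, 0 <= wW s2 o z].
  by split=> *; rewrite /= !mulr_ge0 ?ler01 ?ler0n.
have [M0 U0 V0 W0] := s2_ge0.
have hmain := @prod8_bound _ s2 2 a b c M0 U0 V0 W0 isT good2 a1 b1 c1.
set L := avg _ in hmain.
pose T := avg (fun o : Om => avg3 (fun p u r => T2 p u r * (a o p u * b o p r * c o u r))).
have O3_split : O3 aux_bal = L + (dH ^+ 8 - dA) * T.
  rewrite O3E /T -avgZ -avgD; apply: eq_avg => o.
  rewrite -avgZ -avgD; apply: eq_avg => p; rewrite -avgZ -avgD; apply: eq_avg => u.
  rewrite -avgZ -avgD; apply: eq_avg => r.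
  have e (w A B C D K : R) : w * K = K ->
      (A - B * C) * K = w * (A - D * C) * K + (D - B) * (C * K).
    by move=> h; rewrite [w * _ * K]mulrAC h; ring.
  exact: e (absorb o p u r).
have hT : `|T| <= q ^+ 16 *+ 2.
  apply: le_trans double_dbl_count.
  (* The four triples of even parity contain each of the twelve pairs of
     classes of doubled vertices exactly once, so the other four factors can
     be bounded by 1 without loss. *)
  apply: le_trans (_ : avg (fun o : Om => avg3 (fun p u r => T2 p u r *
    T2 p (U1 o) (R1 o) * T2 (P1 o) u (R1 o) * T2 (P1 o) (U1 o) r)) <= _).
    apply: le_trans (norm_avg _) _; apply: le_avg => o.
    apply: le_trans (norm_avg _) _; apply: le_avg => p.
    apply: le_trans (norm_avg _) _; apply: le_avg => u.
    apply: le_trans (norm_avg _) _; apply: le_avg => r.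
    have T0 p' u' r' : 0 <= T2 p' u' r' by rewrite -star_aux_tri2 ler0n.
    rewrite normrM (ger0_norm (T0 _ _ _)) -[leRHS]mulrA -[leRHS]mulrA ler_wpM2l //.
    have -> : a o p u * b o p r * c o u r =
      (aux_bal p (U1 o) (R1 o) * (aux_bal (P1 o) u (R1 o) * aux_bal (P1 o) (U1 o) r)) *
      (aux_bal p u (R1 o) * (aux_bal p (U1 o) r * (aux_bal (P1 o) u r *
        aux_bal (P1 o) (U1 o) (R1 o)))) by rewrite /a /b /c; ring.
    rewrite normrM -[leRHS]mulr1 ler_pM //; last by rewrite !norm_mul_le1 ?aux_bal_le1.
    rewrite !normrM ler_pM ?mulr_ge0 ?aux_bal_norm //.
    by rewrite ler_pM ?aux_bal_norm.
  rewrite le_eqVlt; apply/orP; left; apply/eqP.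
  rewrite avg_Om [RHS]avg_pair [RHS]exchange_avg; apply: eq_avg => p1.
  under [RHS]eq_avg do rewrite avg_pair exchange_avg.
  rewrite [RHS]exchange_avg; apply: eq_avg => u1.
  under [RHS]eq_avg do under eq_avg do rewrite avg_pair exchange_avg.
  under [RHS]eq_avg do rewrite exchange_avg.
  rewrite [RHS]exchange_avg; apply: eq_avg => r1.
  apply: eq_avg => p; apply: eq_avg => u; apply: eq_avg => r.
  rewrite /tri2 /P1 /U1 /R1 /= -!surjective_pairing [dbl D12 _ _]/dbl [dbl D13 _ _]/dbl.
  by rewrite [dbl D23 _ _]/dbl /=; ring.
have := ler_norm L; have := dens_aux_close; rewrite distrC => hd.
have Q0 : 0 <= q ^+ 16 by rewrite exprn_ge0 // ltW.
have : (dH ^+ 8 - dA) * T <= delta *+ 16 * (q ^+ 16 *+ 2).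
  by apply: le_trans (ler_norm _) _; rewrite normrM ler_pM.
by rewrite O3_split; move: hmain; lra.
Qed.

Lemma tri_qr_aux eta' :
  delta * q ^+ 16 *+ 40 < eta' * (d12 R (aux H) * d13 R (aux H) * d23 R (aux H)) ^+ 4 ->
  tri_qr eta' (aux H).
Proof.
apply: le_lt_trans; apply: le_trans O3_aux_bound.
rewrite le_eqVlt; apply/orP; left; apply/eqP.
do 6!(apply: eq_avg => ?); do 3!(apply: eq_bigr => ? _).
by rewrite /aux_bal star_aux_tri2 aux123_prod8.
Qed.

Lemma weighted_prod8_count u v w : bounded1 u -> bounded1 v -> bounded1 w ->
  `|avg3 (fun p s r => prod8 f p s r * (u p * v s * w r)) -
    dH ^+ 8 * q ^+ 4 * (avg u * avg v * avg w)| <= delta * q ^+ 4 *+ 8 + eps *+ 12.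
Proof.
move=> hu hv hw; have h1 := prod8_count hu hv hw; have h2 := T2_count hu hv hw.
set A := avg3 _ in h1 *; set B := avg3 _ in h1 h2.
have -> : A - dH ^+ 8 * q ^+ 4 * (avg u * avg v * avg w) =
  A - dH ^+ 8 * B + dH ^+ 8 * (B - q ^+ 4 * (avg u * avg v * avg w)) by ring.
apply: le_trans (ler_normD _ _) _; apply: lerD => //.
rewrite normrM -[leRHS]mul1r ler_pM // norm_exp_le1 //.
by case/andP: dH_01 => d0 d1; rewrite ger0_norm.
Qed.

End AuxiliaryComplex.

(** * Random edges *)

Section EdgePairs.
Variable R : realFieldType.

(** Stated for ordered pairs, so that choosing an edge becomes an average over a vertex class of
    [H']; diagonal pairs give singletons, which no graph contains. *)
Definition edge_ind (X : finType) (G : {set {set X}}) (p : X * X) : R :=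
  (([set p.1; p.2] \in G) : nat)%:R.

Lemma edge_ind_le1 (X : finType) (G : {set {set X}}) : bounded1 (edge_ind G).
Proof. by move=> p; apply: bool_norm. Qed.

Lemma card_ordered_pairs (X : finType) (e : {set X}) : #|e| = 2%N ->
  #|[pred p : X * X | [set p.1; p.2] == e]| = 2%N.
Proof.
move=> /eqP/cards2P[x [y [xy ->]]].
have -> : 2%N = #|[set (x, y); (y, x)]|.
  by rewrite cards2 xpair_eqE negb_and xy.
apply: eq_card => -[a b]; rewrite !inE !xpair_eqE /=.
apply/eqP/idP => [h|/orP[]/andP[/eqP-> /eqP->] //]; last by rewrite setUC.
have ha : a \in [set x; y] by rewrite -h !inE eqxx.
have hb : b \in [set x; y] by rewrite -h !inE eqxx orbT.
have hx : x \in [set a; b] by rewrite h !inE eqxx.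
have hy : y \in [set a; b] by rewrite h !inE eqxx orbT.
move: ha hb hx hy xy; rewrite !inE.
do 4!case/orP=> /eqP ?; subst; rewrite ?eqxx ?orbT //.
Qed.

Lemma sum_edge_ind (X : finType) (G : {set {set X}}) (phi : {set X} -> R) :
  is_graph G ->
  \sum_p edge_ind G p * phi [set p.1; p.2] = (\sum_(e in G) phi e) *+ 2.
Proof.
move=> hG; rewrite (eq_bigr (fun p : X * X => if [set p.1; p.2] \in G then
    phi [set p.1; p.2] else 0)); last first.
  by move=> p _; rewrite /edge_ind; case: ifP; rewrite ?mul1r ?mul0r.
rewrite -big_mkcond /= (partition_big (fun p : X * X => [set p.1; p.2]) (mem G)) //=.
rewrite -sumrMnl; apply: eq_bigr => e eG.
rewrite (eq_bigr (fun=> phi e)); last by move=> p /andP[_ /eqP->].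
rewrite sumr_const -(card_ordered_pairs (hG e eG)); congr (_ *+ _).
apply: eq_card => p; rewrite !unfold_in /=; apply/andP/eqP => [[_ /eqP]|h] //.
by rewrite h; split; [exact: eG | exact: eqxx].
Qed.

Lemma avg_edge_ind (X : finType) (G : {set {set X}}) : is_graph G ->
  avg (edge_ind G) = #|G|%:R *+ 2 / (#|X| ^ 2)%:R.
Proof.
move=> hG; rewrite /avg card_prod mulnn; congr (_ / _).
have := sum_edge_ind (fun=> 1) hG; rewrite sumr_const => <-.
by apply: eq_bigr => p _; rewrite mulr1.
Qed.

Lemma prod8_forall (X1 X2 X3 : finType) (H : cplx X1 X2 X3) p u r :
  prod8 (fun x y z => (c123 H x y z : nat)%:R : R) p u r =
  ([forall x in [set p.1; p.2], forall y in [set u.1; u.2],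
     forall z in [set r.1; r.2], c123 H x y z] : nat)%:R.
Proof.
have e (X : finType) (a b : X) (P : pred X) :
    [forall x in [set a; b], P x] = P a && P b.
  apply/forallP/andP => [h|[ha hb] x].
    by split; apply: (implyP (h _)); rewrite !inE eqxx ?orbT.
  by apply/implyP; rewrite !inE => /orP[]/eqP->.
by rewrite !e /prod8 !bool_and; ring.
Qed.

(** Each edge comes from two ordered pairs, so each triple of edges is counted eight times; this
    factor and the normalisations cancel in the quotient. *)
Lemma prob_all8_avg (X1 X2 X3 : finType) (H : cplx X1 X2 X3) G1 G2 G3 :
  (0 < #|X1|)%N -> (0 < #|X2|)%N -> (0 < #|X3|)%N ->
  is_graph G1 -> is_graph G2 -> is_graph G3 ->
  prob_all8 R H G1 G2 G3 =
  avg3 (fun p u r => prod8 (fun x y z => (c123 H x y z : nat)%:R : R) p u r *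
    (edge_ind G1 p * edge_ind G2 u * edge_ind G3 r)) /
  (avg (edge_ind G1) * avg (edge_ind G2) * avg (edge_ind G3)).
Proof.
move=> X1_gt0 X2_gt0 X3_gt0 h1 h2 h3.
pose phi (a : {set X1}) (b : {set X2}) (c : {set X3}) : R :=
  ([forall x in a, forall y in b, forall z in c, c123 H x y z] : nat)%:R.
pose N : R := \sum_(a in G1) \sum_(b in G2) \sum_(c in G3) phi a b c.
have -> : prob_all8 R H G1 G2 G3 = N / (#|G1| * #|G2| * #|G3|)%:R.
  rewrite /prob_all8; congr (_ / _).
  rewrite -sum1_card natr_sum /N pair_big /= pair_big /= big_mkcond [RHS]big_mkcond.
  apply: eq_bigr => -[[a b] c] _ /=; rewrite inE /= /phi.
  by case: (a \in G1); case: (b \in G2); case: (c \in G3) => //=; case: ifP.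
have hN : N *+ 8 = \sum_p \sum_u \sum_r
    prod8 (fun x y z => (c123 H x y z : nat)%:R : R) p u r *
    (edge_ind G1 p * edge_ind G2 u * edge_ind G3 r).
  rewrite /N (mulrnA _ 2 4) -(sum_edge_ind _ h1) -sumrMnl; apply: eq_bigr => p _.
  rewrite -mulrnAr (mulrnA _ 2 2) -(sum_edge_ind _ h2) -sumrMnl mulr_sumr.
  apply: eq_bigr => u _; rewrite -mulrnAr -(sum_edge_ind _ h3) !mulr_sumr.
  apply: eq_bigr => r _; rewrite prod8_forall /phi; ring.
rewrite !avg_edge_ind //.
have -> (F : X1 * X1 -> X2 * X2 -> X3 * X3 -> R) : avg3 F =
    (\sum_p \sum_u \sum_r F p u r) /
    ((#|X1| ^ 2)%:R * (#|X2| ^ 2)%:R * (#|X3| ^ 2)%:R).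
  rewrite /avg3 /avg; under eq_bigr => p _ do rewrite -mulr_suml.
  rewrite -!mulr_suml !card_prod -!mulnn -!mulrA -!invfM; congr (_ / _); ring.
rewrite -hN; set D1 : R := (#|X1| ^ 2)%:R; set D2 : R := (#|X2| ^ 2)%:R.
set D3 : R := (#|X3| ^ 2)%:R.
have D1n : D1 != 0 by rewrite pnatr_eq0 -lt0n expn_gt0 X1_gt0.
have D2n : D2 != 0 by rewrite pnatr_eq0 -lt0n expn_gt0 X2_gt0.
have D3n : D3 != 0 by rewrite pnatr_eq0 -lt0n expn_gt0 X3_gt0.
clearbody D1 D2 D3; rewrite !natrM.
have -> : #|G1|%:R *+ 2 / D1 * (#|G2|%:R *+ 2 / D2) * (#|G3|%:R *+ 2 / D3) =
  (#|G1|%:R * #|G2|%:R * #|G3|%:R) * (8 / (D1 * D2 * D3)) :> R by field; rewrite D1n D2n D3n.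
set M := _ * _ * _; have n0 : 8 / (D1 * D2 * D3) != 0
  by rewrite mulf_neq0 ?invr_eq0 ?mulf_neq0 ?pnatr_eq0.
by rewrite -(mulr_natr N) -(mulrA N) -[RHS]mulf_div divff // mulr1.
Qed.

End EdgePairs.

(** * From the error terms to the stated constants *)

Section Assembly.
Variables (R : realFieldType) (X1 X2 X3 : finType) (H : cplx X1 X2 X3).
Variables (eps' d3 eta3' eps3 eta3 d2 eta2' eps2 eta2 delta e : R).
Hypothesis complexH : is_complex H.
Hypotheses (eps'_gt0 : 0 < eps') (eps3_gt0 : 0 < eps3) (d3_gt0 : 0 < d3) (eta3'_gt0 : 0 < eta3')
  (eta3_01 : 0 < eta3 <= 1) (d2_gt0 : 0 < d2) (eps2_01 : 0 < eps2 < 1 / 2)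
  (delta_gt0 : 0 < delta) (e_gt0 : 0 < e).
Hypotheses (delta_eps3 : delta * (512 * 512) <= eps3 * d3 ^+ 8)
  (delta_eta3' : delta * (512 * 512) <= eta3')
  (delta_eps' : delta * (512 * 512) <= eps' ^+ 4 * d3 ^+ 8)
  (eta3_small : eta3 *+ 256 <= delta ^+ 8).
Hypotheses (e_eta3 : e * 1000 <= eta3 * d2 ^+ 96) (e_eps2 : e * 1000 <= eps2 * d2 ^+ 96)
  (e_eta2' : e * 1000 <= eta2') (e_eps' : e * 1000 <= eps' ^+ 4 * d3 ^+ 8 * d2 ^+ 96)
  (eta2_small : eta2 <= e ^+ 4).
Hypotheses (qr12 : graph_qr eta2 (c12 H)) (ge12 : d2 <= d12 R H)
  (qr13 : graph_qr eta2 (c13 H)) (ge13 : d2 <= d13 R H)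
  (qr23 : graph_qr eta2 (c23 H)) (ge23 : d2 <= d23 R H)
  (qr123 : tri_qr eta3 H) (ge123 : d3 <= d123 R H).

Local Notation q := (d12 R H * d13 R H * d23 R H).

Lemma dens_ge_01 (X Y : finType) (g : X -> Y -> bool) : d2 <= dens R g ->
  0 < dens R g <= 1.
Proof.
by move=> h; have /andP[_ ->] := dens_01 R g; rewrite (lt_le_trans d2_gt0 h).
Qed.

Let p12_01 : 0 < d12 R H <= 1 := dens_ge_01 ge12.
Let p13_01 : 0 < d13 R H <= 1 := dens_ge_01 ge13.
Let p23_01 : 0 < d23 R H <= 1 := dens_ge_01 ge23.

Let X1_gt0 : (0 < #|X1|)%N.
Proof. by case/andP: p12_01 => /dens_gt0_card/andP[]. Qed.
Let X2_gt0 : (0 < #|X2|)%N.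
Proof. by case/andP: p12_01 => /dens_gt0_card/andP[]. Qed.
Let X3_gt0 : (0 < #|X3|)%N.
Proof. by case/andP: p13_01 => /dens_gt0_card/andP[]. Qed.

Let d2_le1 : d2 <= 1.
Proof. by case/andP: p12_01 => _; apply: le_trans. Qed.

(** [q] is at least [d2 ^+ 3], whence 96 = 3 * 32. *)
Lemma pow_d2_le (n : nat) : (n <= 32)%N -> d2 ^+ 96 <= q ^+ n.
Proof.
move=> hn; apply: le_trans (_ : d2 ^+ (3 * n) <= _).
  by apply: ler_wiXn2l; rewrite ?(ltW d2_gt0) // (leq_mul (leqnn 3) hn).
have d0 := ltW d2_gt0.
have h12 : d2 * d2 <= d12 R H * d13 R H by apply: ler_pM.
have hq : d2 ^+ 3 <= q.
  have -> : d2 ^+ 3 = d2 * d2 * d2 by ring.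
  by apply: ler_pM => //; apply: mulr_ge0.
have d30 : 0 <= d2 ^+ 3 by apply: exprn_ge0.
by rewrite exprM lerXn2r ?nnegrE // (le_trans d30 hq).
Qed.

Let cutH (X Y : finType) (g : X -> Y -> bool) : graph_qr eta2 g ->
  cut (fun x y => (g x y : nat)%:R : R) (dens R g) e.
Proof. exact: cut_of_graph_qr (ltW e_gt0) eta2_small. Qed.

Lemma aux_graph_regular (X Y : finType) (g : X -> Y -> bool) :
  graph_qr eta2 g -> d2 <= dens R g ->
  graph_qr eta2' (pair_graph g) /\
  (1 - eps2) * dens R g ^+ 4 <= dens R (pair_graph g) <= (1 + eps2) * dens R g ^+ 4.
Proof.
move=> hqr hd; have /andP[d0 d1] := dens_ge_01 hd.
have /andP[X0 Y0] := dens_gt0_card d0.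
have [h1 h2] := pair_graph_regular X0 Y0 (cutH hqr).
split; first by apply: h2; move: e_gt0 e_eta2'; lra.
have : eps2 * d2 ^+ 96 <= eps2 * dens R g ^+ 4.
  rewrite ler_wpM2l //; first by case/andP: eps2_01 => /ltW.
  apply: le_trans (_ : d2 ^+ 4 <= _).
    by rewrite ler_wiXn2l ?(le_trans hd) // ltW.
  by rewrite lerXn2r ?nnegrE ?(ltW d2_gt0) ?(ltW d0).
by move: h1 e_eps2 e_gt0; rewrite ler_norml => *; apply/andP; split; lra.
Qed.

Let eps_small : e *+ 100 <= eta3 * q ^+ 32.
Proof.
apply: le_trans (_ : eta3 * d2 ^+ 96 <= _); first by move: e_eta3 e_gt0; lra.
by rewrite ler_wpM2l ?pow_d2_le //; case/andP: eta3_01 => /ltW.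
Qed.

Let q_gt0 : 0 < q.
Proof.
have [[h12 _] [h13 _] [h23 _]] := And3 (andP p12_01) (andP p13_01) (andP p23_01).
by apply: mulr_gt0 => //; apply: mulr_gt0.
Qed.

Let dens_pow : d3 ^+ 8 <= d123 R H ^+ 8.
Proof. by have d0 := ltW d3_gt0; rewrite lerXn2r ?nnegrE // (le_trans d0). Qed.

Lemma aux_dens_bounds :
  (1 - eps3) * d123 R H ^+ 8 <= d123 R (aux H) <= (1 + eps3) * d123 R H ^+ 8.
Proof.
have hclose := dens_aux_close complexH X1_gt0 X2_gt0 X3_gt0 p12_01 p13_01 p23_01
  (cutH qr12) (cutH qr13) (cutH qr23) eta3_01 delta_gt0 eta3_small eps_small qr123.
have h : eps3 * d3 ^+ 8 <= eps3 * d123 R H ^+ 8.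
  by rewrite ler_wpM2l ?(ltW eps3_gt0) ?dens_pow.
move: hclose delta_eps3 delta_gt0; rewrite ler_norml => /andP[? ?] ? ?.
by apply/andP; split; lra.
Qed.

Lemma aux_tri_qr : tri_qr eta3' (aux H).
Proof.
apply: (tri_qr_aux complexH X1_gt0 X2_gt0 X3_gt0 p12_01 p13_01 p23_01
  (cutH qr12) (cutH qr13) (cutH qr23) eta3_01 delta_gt0 eta3_small eps_small qr123).
have half (X Y : finType) (g : X -> Y -> bool) : graph_qr eta2 g -> d2 <= dens R g ->
    dens R g ^+ 4 / 2 <= dens R (pair_graph g).
  move=> hqr hd; have [_ /andP[h _]] := aux_graph_regular hqr hd.
  have := @exprn_ge0 R 4 (dens R g) (le_trans (ltW d2_gt0) hd).
  move: h; case/andP: eps2_01 => ? ? h ?; apply: le_trans h.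
  by rewrite mulrC ler_wpM2r //; lra.
have q16 : 0 < q ^+ 16 by rewrite exprn_gt0.
set p' := d12 R (aux H) * d13 R (aux H) * d23 R (aux H).
have hp : q ^+ 4 / 8 <= p'.
  have -> : q ^+ 4 / 8 = d12 R H ^+ 4 / 2 * (d13 R H ^+ 4 / 2) * (d23 R H ^+ 4 / 2) by field.
  have n0 (p : R) : 0 < p -> 0 <= p ^+ 4 / 2 by move=> h; rewrite divr_ge0 ?exprn_ge0 ?ltW.
  have h1 := half _ _ _ qr12 ge12; have h2 := half _ _ _ qr13 ge13.
  have h3 := half _ _ _ qr23 ge23.
  have n1 := n0 _ (proj1 (andP p12_01)); have n2 := n0 _ (proj1 (andP p13_01)).
  have n3 := n0 _ (proj1 (andP p23_01)).
  apply: ler_pM h3 => //; first exact: mulr_ge0.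
  exact: ler_pM.
(* Halving three densities costs 8, and 8^4 = 4096. Since 40 * 4096 < 512 * 512, [delta_eta3']
   outweighs the constant 40 of [O3_aux_bound]. *)
have hp4 : q ^+ 16 / 4096 <= p' ^+ 4.
  have -> : q ^+ 16 / 4096 = (q ^+ 4 / 8) ^+ 4 by field.
  have h0 : 0 <= q ^+ 4 / 8 by rewrite divr_ge0 ?exprn_ge0 ?(ltW q_gt0).
  by rewrite lerXn2r ?nnegrE // (le_trans h0).
have := ler_wpM2l (ltW eta3'_gt0) hp4.
have := ler_wpM2r (ltW q16) delta_eta3'; have := mulr_gt0 delta_gt0 q16.
by lra.
Qed.

Lemma edge_density (X : finType) (G : {set {set X}}) : (0 < #|X|)%N -> is_graph G ->
  eps' * (#|X| ^ 2)%:R < #|G|%:R -> eps' <= avg (@edge_ind R X G).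
Proof.
move=> X0 hG h; rewrite avg_edge_ind // ler_pdivlMr ?ltr0n ?expn_gt0 ?X0 //.
by rewrite mulr2n; have := ler0n R #|G|; lra.
Qed.

(** The normalising product [Gam] of the three edge densities is at least [eps' ^+ 3], so a relative
    error [eps'] leaves room for an absolute error of [eps' ^+ 4] times the expected density. *)
Lemma prob_all8_bounds (G1 : {set {set X1}}) (G2 : {set {set X2}}) (G3 : {set {set X3}}) :
  is_graph G1 -> is_graph G2 -> is_graph G3 ->
  eps' * (#|X1| ^ 2)%:R < #|G1|%:R ->
  eps' * (#|X2| ^ 2)%:R < #|G2|%:R ->
  eps' * (#|X3| ^ 2)%:R < #|G3|%:R ->
  let D := d12 R H ^+ 4 * d13 R H ^+ 4 * d23 R H ^+ 4 * d123 R H ^+ 8 in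
  (1 - eps') * D <= prob_all8 R H G1 G2 G3 <= (1 + eps') * D.
Proof.
move=> h1 h2 h3 /(edge_density X1_gt0 h1) k1 /(edge_density X2_gt0 h2) k2.
move=> /(edge_density X3_gt0 h3) k3; cbv zeta.
set D := d12 R H ^+ 4 * d13 R H ^+ 4 * d23 R H ^+ 4 * d123 R H ^+ 8.
have := weighted_prod8_count complexH X1_gt0 X2_gt0 X3_gt0 p12_01 p13_01 p23_01
  (cutH qr12) (cutH qr13) (cutH qr23) eta3_01 delta_gt0 eta3_small eps_small qr123
  (@edge_ind_le1 R _ G1) (@edge_ind_le1 R _ G2) (@edge_ind_le1 R _ G3).
rewrite prob_all8_avg //; set A := avg3 _; set Gam := avg _ * _ * _.
have -> : d123 R H ^+ 8 * q ^+ 4 = D by rewrite /D; ring.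
move=> hA; have eps0 := ltW eps'_gt0.
have Gam_ge : eps' ^+ 3 <= Gam.
  have -> : eps' ^+ 3 = eps' * eps' * eps' by ring.
  by apply: ler_pM => //; [exact: mulr_ge0 | exact: ler_pM].
have Gam_gt0 : 0 < Gam by apply: lt_le_trans Gam_ge; rewrite exprn_gt0.
have Q0 : 0 < q ^+ 4 by rewrite exprn_gt0.
have hD : eps' ^+ 4 * (d3 ^+ 8 * q ^+ 4) <= eps' * (D * Gam).
  have -> : eps' ^+ 4 * (d3 ^+ 8 * q ^+ 4) = eps' * ((d3 ^+ 8 * q ^+ 4) * eps' ^+ 3) by ring.
  have -> : D = d123 R H ^+ 8 * q ^+ 4 by rewrite /D; ring.
  have d80 : 0 <= d3 ^+ 8 by rewrite exprn_ge0 // ltW.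
  apply: ler_wpM2l => //; apply: ler_pM => //.
  - by apply: mulr_ge0 => //; exact: ltW.
  - by rewrite exprn_ge0.
  - by apply: ler_wpM2r; first exact: ltW.
have herr : delta * q ^+ 4 *+ 8 + e *+ 12 <= eps' ^+ 4 * (d3 ^+ 8 * q ^+ 4).
  have := ler_wpM2r (ltW Q0) delta_eps'.
  have : eps' ^+ 4 * d3 ^+ 8 * d2 ^+ 96 <= eps' ^+ 4 * d3 ^+ 8 * q ^+ 4.
    by rewrite ler_wpM2l ?pow_d2_le // mulr_ge0 ?exprn_ge0 // ltW.
  by have := mulr_gt0 delta_gt0 Q0; move: e_eps' e_gt0; rewrite -!(mulrA (eps' ^+ 4)); lra.
move: hA; rewrite ler_norml => /andP[hA1 hA2].
rewrite ler_pdivlMr // ler_pdivrMr // -!(mulrA _ D Gam).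
by apply/andP; split; lra.
Qed.

End Assembly.

Lemma le_mul_unit (R : realFieldType) (x y : R) : 0 <= x -> 0 <= y <= 1 -> x * y <= x.
Proof. by move=> x0 /andP[_ y1]; rewrite ler_piMr. Qed.

Lemma unit_mul (R : realFieldType) (x y : R) : 0 <= x <= 1 -> 0 <= y <= 1 -> 0 <= x * y <= 1.
Proof. by move=> /andP[? ?] /andP[? ?]; rewrite mulr_ge0 // mulr_ile1. Qed.

Lemma unit_exp (R : realFieldType) (x : R) n : 0 <= x <= 1 -> 0 <= x ^+ n <= 1.
Proof. by move=> /andP[? ?]; rewrite exprn_ge0 // exprn_ile1. Qed.

Theorem mainTheorem7 (R : realFieldType) :
  forall eps' d3 : R, 0 < eps' < 1 -> 0 < d3 < 1 ->
  exists2 c1 : R, 0 < c1 & forall eta3' : R, 0 < eta3' < c1 ->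
  exists2 c2 : R, 0 < c2 & forall eps3 : R, 0 < eps3 < c2 ->
  exists2 c3 : R, 0 < c3 & forall eta3 : R, 0 < eta3 < c3 ->
  exists2 c4 : R, 0 < c4 & forall d2 : R, 0 < d2 < c4 ->
  exists2 c5 : R, 0 < c5 & forall eta2' : R, 0 < eta2' < c5 ->
  exists2 c6 : R, 0 < c6 & forall eps2 : R, 0 < eps2 < c6 ->
  exists2 c7 : R, 0 < c7 & forall eta2 : R, 0 < eta2 < c7 ->
  exists N : nat, forall n : nat, (N <= n)%N ->
  forall (X1 X2 X3 : finType) (H : cplx X1 X2 X3),
    is_complex H ->
    (n <= #|X1|)%N -> (n <= #|X2|)%N -> (n <= #|X3|)%N ->
    graph_qr eta2 (c12 H) -> d2 <= d12 R H ->
    graph_qr eta2 (c13 H) -> d2 <= d13 R H ->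
    graph_qr eta2 (c23 H) -> d2 <= d23 R H ->
    tri_qr eta3 H -> d3 <= d123 R H ->
    [/\ graph_qr eta2' (c12 (aux H)) /\
          (1 - eps2) * d12 R H ^+ 4 <= d12 R (aux H) <= (1 + eps2) * d12 R H ^+ 4,
        graph_qr eta2' (c13 (aux H)) /\
          (1 - eps2) * d13 R H ^+ 4 <= d13 R (aux H) <= (1 + eps2) * d13 R H ^+ 4,
        graph_qr eta2' (c23 (aux H)) /\
          (1 - eps2) * d23 R H ^+ 4 <= d23 R (aux H) <= (1 + eps2) * d23 R H ^+ 4,
        tri_qr eta3' (aux H) /\
          (1 - eps3) * d123 R H ^+ 8 <= d123 R (aux H) <= (1 + eps3) * d123 R H ^+ 8
      & forall (G1 : {set {set X1}}) (G2 : {set {set X2}}) (G3 : {set {set X3}}),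
          is_graph G1 -> is_graph G2 -> is_graph G3 ->
          eps' * (#|X1| ^ 2)%:R < #|G1|%:R ->
          eps' * (#|X2| ^ 2)%:R < #|G2|%:R ->
          eps' * (#|X3| ^ 2)%:R < #|G3|%:R ->
          let D := d12 R H ^+ 4 * d13 R H ^+ 4 * d23 R H ^+ 4 * d123 R H ^+ 8 in
          (1 - eps') * D <= prob_all8 R H G1 G2 G3 <= (1 + eps') * D].
Proof.
move=> eps' d3 /andP[eps'_gt0 eps'_lt1] /andP[d3_gt0 d3_lt1].
exists 1 => // eta3' /andP[eta3'_gt0 eta3'_lt1].
exists 1 => // eps3 /andP[eps3_gt0 eps3_lt1].
(* All factors are in the unit interval, so the product lies below each of the partial products that
   [delta] has to be compared with. *)
pose delta := eps3 * eta3' * eps' ^+ 4 * d3 ^+ 8 / (512 * 512).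
have u_eps' : 0 <= eps' <= 1 by rewrite !ltW.
have u_d3 : 0 <= d3 <= 1 by rewrite !ltW.
have u_eta3' : 0 <= eta3' <= 1 by rewrite !ltW.
have u_eps3 : 0 <= eps3 <= 1 by rewrite !ltW.
have delta_gt0 : 0 < delta by rewrite divr_gt0 ?mulr_gt0 ?exprn_gt0 ?ltr0n.
have n512 : 512 * 512 != 0 :> R by rewrite mulf_neq0 // pnatr_eq0.
have deltaE : delta * (512 * 512) = eps3 * eta3' * eps' ^+ 4 * d3 ^+ 8 by rewrite divfK.
exists (delta ^+ 8 / 256); first by rewrite divr_gt0 ?exprn_gt0 ?ltr0n.
move=> eta3 /andP[eta3_gt0 eta3_lt].
have delta_le1 : delta <= 1.
  have : eps3 * eta3' * eps' ^+ 4 * d3 ^+ 8 <= 1.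
    by have /andP[] := unit_mul (unit_mul (unit_mul u_eps3 u_eta3') (unit_exp 4 u_eps'))
      (unit_exp 8 u_d3).
  by rewrite -deltaE; lra.
have eta3_small : eta3 *+ 256 <= delta ^+ 8.
  by rewrite -mulr_natr -ler_pdivlMr ?ltr0n // ltW.
have eta3_01 : 0 < eta3 <= 1.
  rewrite eta3_gt0 /=; have : delta ^+ 8 <= 1 by rewrite exprn_ile1 // ltW.
  by move: eta3_lt; lra.
exists 1 => // d2 /andP[d2_gt0 d2_lt1].
exists 1 => // eta2' /andP[eta2'_gt0 eta2'_lt1].
(* This keeps the graph densities of [H'] above half of their expected values. *)
exists (1 / 2); first by rewrite divr_gt0 ?ltr0n.
move=> eps2 /andP[eps2_gt0 eps2_lt].
(* Again a product below every required bound; [d2 ^+ 96] makes graph errors negligible against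
   [q ^+ 32], and 1000 covers all numbers of edge replacements. *)
pose e := eta3 * d2 ^+ 96 * eps2 * eta2' * eps' ^+ 4 * d3 ^+ 8 / 1000.
have e_gt0 : 0 < e by rewrite divr_gt0 ?mulr_gt0 ?exprn_gt0 ?ltr0n.
have eE : e * 1000 = eta3 * d2 ^+ 96 * eps2 * eta2' * eps' ^+ 4 * d3 ^+ 8.
  by rewrite divfK // pnatr_eq0.
exists (e ^+ 4); first by rewrite exprn_gt0.
move=> eta2 /andP[_ /ltW eta2_le].
exists 0%N => n _ X1 X2 X3 H cH _ _ _ qr12 ge12 qr13 ge13 qr23 ge23 qr123 ge123.
have u_d2 : 0 <= d2 <= 1 by rewrite !ltW.
have u_eta2' : 0 <= eta2' <= 1 by rewrite !ltW.
have u_eta3 : 0 <= eta3 <= 1 by case/andP: eta3_01 => /ltW ->.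
have u_eps2 : 0 <= eps2 <= 1 by clear -eps2_gt0 eps2_lt; apply/andP; split; lra.
have u4 := unit_exp 4 u_eps'; have u8 := unit_exp 8 u_d3; have u96 := unit_exp 96 u_d2.
have prodE (a b c : R) : c = a * b -> 0 <= a <= 1 -> 0 <= b <= 1 -> c <= a.
  by move=> -> /andP[a0 _] hb; apply: le_mul_unit.
have delta_eps3 : delta * (512 * 512) <= eps3 * d3 ^+ 8.
  by apply: (prodE _ (eta3' * eps' ^+ 4)); rewrite ?unit_mul // deltaE; ring.
have delta_eta3' : delta * (512 * 512) <= eta3'.
  by apply: (prodE _ (eps3 * eps' ^+ 4 * d3 ^+ 8)); rewrite ?unit_mul // deltaE; ring.
have delta_eps' : delta * (512 * 512) <= eps' ^+ 4 * d3 ^+ 8.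
  by apply: (prodE _ (eps3 * eta3')); rewrite ?unit_mul // deltaE; ring.
have e_eta3 : e * 1000 <= eta3 * d2 ^+ 96.
  by apply: (prodE _ (eps2 * eta2' * eps' ^+ 4 * d3 ^+ 8)); rewrite ?unit_mul // eE; ring.
have e_eps2 : e * 1000 <= eps2 * d2 ^+ 96.
  by apply: (prodE _ (eta3 * eta2' * eps' ^+ 4 * d3 ^+ 8)); rewrite ?unit_mul // eE; ring.
have e_eta2' : e * 1000 <= eta2'.
  by apply: (prodE _ (eta3 * d2 ^+ 96 * eps2 * eps' ^+ 4 * d3 ^+ 8)); rewrite ?unit_mul // eE; ring.
have e_eps' : e * 1000 <= eps' ^+ 4 * d3 ^+ 8 * d2 ^+ 96.
  by apply: (prodE _ (eta3 * eps2 * eta2')); rewrite ?unit_mul // eE; ring.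
have eps2_01 : 0 < eps2 < 1 / 2 by rewrite eps2_gt0.
split.
- exact: (aux_graph_regular d2_gt0 eps2_01 e_gt0 e_eps2 e_eta2' eta2_le qr12 ge12).
- exact: (aux_graph_regular d2_gt0 eps2_01 e_gt0 e_eps2 e_eta2' eta2_le qr13 ge13).
- exact: (aux_graph_regular d2_gt0 eps2_01 e_gt0 e_eps2 e_eta2' eta2_le qr23 ge23).
- split; first exact: (aux_tri_qr cH eta3'_gt0 eta3_01 d2_gt0 eps2_01 delta_gt0 e_gt0
    delta_eta3' eta3_small e_eta3 e_eps2 e_eta2' eta2_le qr12 ge12 qr13 ge13 qr23 ge23).
  exact: (aux_dens_bounds cH eps3_gt0 d3_gt0 eta3_01 d2_gt0 delta_gt0 e_gt0 delta_eps3
    eta3_small e_eta3 eta2_le qr12 ge12 qr13 ge13 qr23 ge23).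
- move=> G1 G2 G3; exact: (prob_all8_bounds cH eps'_gt0 d3_gt0 eta3_01 d2_gt0 delta_gt0
    e_gt0 delta_eps' eta3_small e_eta3 e_eps' eta2_le qr12 ge12 qr13 ge13 qr23 ge23).
Qed.
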